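(* Let $\varphi\in\mathrm{Lip}(\mathbb{R}^n)$ and $\varepsilon>0$. For a Lipschitz vector field $g$ (as specified below) let $u^\varepsilon(t;c)$ be the solution of the characteristic ODE $\dot u^\varepsilon=g$, $u^\varepsilon(0)=c$, and let $V^\varepsilon(x,t)=\varphi(x_0)$ where $x_0$ is the unique point with $u^\varepsilon(t;x_0)=x$ (the weak solution of $V^\varepsilon_t+g\cdot DV^\varepsilon=0$, $V^\varepsilon(\cdot,0)=\varphi$). (1) Let $n>1$ and $f\in C(\mathbb{R}^{n+1},\mathbb{R}^n)$ be $\kappa$-Lipschitz and $\mathbb{Z}^{n+1}$-periodic in $(r,\tau)$, with $g=f(u^\varepsilon/\varepsilon,t/\varepsilon)$. Assume there is $C_0>0$ such that the solutions $v(\tau;c)$ of $\dot v=f(v,\tau)$, $v(0)=c$, satisfy $v_i(\tau;c^2)-v_i(\tau;c^1)\le C_0$ for all $i$, $\tau>0$, and $c^1,c^2\in\mathbb{R}^n$ with $c^1-c^2\in[0,1]^n$. Then there is $\bar\xi\in\mathbb{R}^n$ such that for all $t>0$, $x\in\mathbb{R}^n$, \[|V^\varepsilon(x,t)-\varphi(x-\bar\xi t)|\leq \|D\varphi\|_\infty\Big(1+C_0+2\max_{1\le i\le n}\|f_i\|_\infty\Big)\varepsilon.\] (2) Let $n=1$. (2-1) If $f\in C(\mathbb{R}^2)$ is $\kappa$-Lipschitz and $\mathbb{Z}^2$-periodic, $g=f(u^\varepsilon/\varepsilon,t/\varepsilon)$, then there is $\bar\xi\in\mathbb{R}$ with $|V^\varepsilon(x,t)-\varphi(x-\bar\xi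 t)|\le \|D\varphi\|_\infty(1+2\|f\|_\infty)\varepsilon$ for all $t>0$, $x\in\mathbb{R}$; if moreover $f(r,\tau)$ is independent of $\tau$, then $|V^\varepsilon(x,t)-\varphi(x-\bar\xi t)|\le \|D\varphi\|_\infty\varepsilon$. (2-2) If $g=f(u^\varepsilon/\varepsilon)$ where $f(r)=F(\xi_0 r)$, with $\xi_0\in\mathbb{R}^d$ having Diophantine index $\sigma_{\xi_0}>0$ (i.e. $|\xi_0\cdot k|\ge C_{\xi_0}|k|^{-\sigma_{\xi_0}}$ for all $k\in\mathbb{Z}^d\setminus\{0\}$, some $C_{\xi_0}>0$), $F\in C^m(\mathbb{T}^d)$, $m>d+\sigma_{\xi_0}$, $F>0$, then there exist $\bar\xi\in\mathbb{R}$ and $C>0$ depending on $d$ and $F$ such that $|V^\varepsilon(x,t)-\varphi(x-\bar\xi t)|\le \|D\varphi\|_\infty C\varepsilon$ for all $t>0$, $x\in\mathbb{R}$.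
   Context: For $c\in\mathbb{R}^n$, $\|c\|=\max_i|c_i|$. For $\varphi\in\mathrm{Lip}(\mathbb{R}^n)$ (globally Lipschitz), $\|D\varphi\|_\infty$ is the smallest $C>0$ with $|\varphi(x)-\varphi(y)|\le C\|x-y\|$ for all $x,y$. $\mathbb{T}^d=\mathbb{R}^d/\mathbb{Z}^d$. *)

(* Defs.v *)
From Stdlib Require Import Reals.
From mathcomp Require Import ssreflect ssrfun ssrbool eqtype ssrnat seq fintype bigop.
Open Scope R_scope.

Definition vec (n : nat) := 'I_n -> R.

Definition normv {n : nat} (x : vec n) : R := \big[Rmax/0]_(i < n) Rabs (x i).

Definition vsub {n : nat} (x y : vec n) : vec n := fun i => x i - y i.

Definition vdrift {n : nat} (x xi : vec n) (t : R) : vec n := fun i => x i - xi i * t.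

Definition vscale {n : nat} (a : R) (x : vec n) : vec n := fun i => a * x i.

Definition lipschitz {n : nat} (phi : vec n -> R) (C : R) : Prop :=
  0 <= C /\ forall x y, Rabs (phi x - phi y) <= C * normv (vsub x y).

Definition is_Lip {n : nat} (phi : vec n -> R) : Prop := exists C, lipschitz phi C.

(* L = ||D phi||_oo : the least Lipschitz constant of phi *)
Definition DLinf {n : nat} (phi : vec n -> R) (L : R) : Prop :=
  lipschitz phi L /\ forall C, lipschitz phi C -> L <= C.

Definition lipschitz1 (phi : R -> R) (C : R) : Prop :=
  0 <= C /\ forall x y, Rabs (phi x - phi y) <= C * Rabs (x - y).
Definition is_Lip1 (phi : R -> R) : Prop := exists C, lipschitz1 phi C.
Definition DLinf1 (phi : R -> R) (L : R) : Prop :=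
  lipschitz1 phi L /\ forall C, lipschitz1 phi C -> L <= C.

Definition lipschitz_rt {n : nat} (f : vec n -> R -> vec n) (kappa : R) : Prop :=
  forall r r' tau tau' i,
    Rabs (f r tau i - f r' tau' i) <= kappa * Rmax (normv (vsub r r')) (Rabs (tau - tau')).

Definition lipschitz_rt1 (f : R -> R -> R) (kappa : R) : Prop :=
  forall r r' tau tau',
    Rabs (f r tau - f r' tau') <= kappa * Rmax (Rabs (r - r')) (Rabs (tau - tau')).

Definition continuous_v {m : nat} (F : vec m -> R) : Prop :=
  forall x eps, 0 < eps -> exists delta, 0 < delta /\
    forall y, normv (vsub y x) < delta -> Rabs (F y - F x) < eps.

Definition continuous_rt {n : nat} (f : vec n -> R -> vec n) : Prop :=
  forall r tau eps, 0 < eps -> exists delta, 0 < delta /\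
    forall r' tau', normv (vsub r' r) < delta -> Rabs (tau' - tau) < delta ->
      forall i, Rabs (f r' tau' i - f r tau i) < eps.

Definition continuous_rt1 (f : R -> R -> R) : Prop :=
  forall r tau eps, 0 < eps -> exists delta, 0 < delta /\
    forall r' tau', Rabs (r' - r) < delta -> Rabs (tau' - tau) < delta ->
      Rabs (f r' tau' - f r tau) < eps.

Definition periodic_rt {n : nat} (f : vec n -> R -> vec n) : Prop :=
  forall r tau (k : 'I_n -> Z) (k0 : Z),
    f (fun i => r i + IZR (k i)) (tau + IZR k0) = f r tau.

Definition periodic_rt1 (f : R -> R -> R) : Prop :=
  forall r tau (k k0 : Z), f (r + IZR k) (tau + IZR k0) = f r tau.

(* Z^d-periodicity: F is a function on the torus T^d = R^d / Z^d *)
Definition periodic_v {d : nat} (F : vec d -> R) : Prop :=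
  forall z (k : 'I_d -> Z), F (fun i => z i + IZR (k i)) = F z.

Definition vupd {d : nat} (x : vec d) (i : 'I_d) (s : R) : vec d :=
  fun j => if j == i then s else x j.

Fixpoint Cm {d : nat} (m : nat) (F : vec d -> R) : Prop :=
  match m with
  | O => continuous_v F
  | S m' => continuous_v F /\
      forall i : 'I_d, exists G : vec d -> R,
        (forall x, derivable_pt_lim (fun s => F (vupd x i s)) (x i) (G x)) /\ Cm m' G
  end.

Definition is_flow {n : nat} (G : vec n -> R -> vec n) (U : vec n -> R -> vec n) : Prop :=
  forall c, U c 0 = c /\
    forall t (i : 'I_n), derivable_pt_lim (fun s => U c s i) t (G (U c t) t i).

Definition is_flow1 (G : R -> R -> R) (U : R -> R -> R) : Prop :=
  forall c, U c 0 = c /\ forall t, derivable_pt_lim (U c) t (G (U c t) t).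

Definition sup_abs {A : Type} (h : A -> R) (M : R) : Prop :=
  is_lub (fun y => exists z, y = Rabs (h z)) M.

Definition dotv {d : nat} (x y : vec d) : R := \big[Rplus/0]_(i < d) (x i * y i).

Definition diophantine {d : nat} (xi0 : vec d) (sigma : R) : Prop :=
  0 < sigma /\ exists Cxi, 0 < Cxi /\
    forall k : 'I_d -> Z, (exists i, k i <> 0%Z) ->
      let kr : vec d := fun i => IZR (k i) in
      Rabs (dotv xi0 kr) >= Cxi * Rpower (normv kr) (- sigma).

(* Main.v *)
(** In the periodic case, rescale to the flow [v] of [f].  Uniqueness for the ODE and
periodicity make the displacement [v c t - c] a cocycle that is periodic in [c]; the
bound on [v] for initial data in a unit cell (monotonicity when [n = 1]) bounds its
oscillation in [c] by [1 + C0].  A cocycle with bounded oscillation is within that bound of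
a linear function of integer times, whose slope is the effective velocity; the fraction of a
period costs [2 M].  No existence theorem is needed: if there is no flow, there is nothing
to prove.

In the quasi-periodic case put [G = 1 / F].  If the line [r |-> G (r xi0)] has an
antiderivative within bounded distance of [A r], then so does time as a function of
position, with speed [1 / A].  Instead of Fourier series, [G] is interpolated on the grid
[(Z / N)^d], [N = 2 n + 1], by a trigonometric polynomial with frequencies [|k_i| <= n].
Summation by parts bounds its coefficients by [B |k|^-m], so by the Diophantine condition
the antiderivatives along the line deviate from linear functions by at most a multiple of
the sum of [|k|^(sigma - m)], uniformly in [N]; the same sum gives a uniform Hölder bound,
hence the convergence of the interpolants to [G]. *)

Require Import Defs.
From HB Require Import structures.
From Stdlib Require Import ZArith Reals Lra Lia FunctionalExtensionality ClassicalEpsilon.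
From Coquelicot Require Compactness.
From mathcomp Require Import ssreflect ssrfun ssrbool eqtype ssrnat div seq fintype finfun bigop.
Open Scope R_scope.

(** * Finite sums and maxima of real numbers *)

Lemma Rabs_le_inv a b : Rabs a <= b -> - b <= a <= b.
Proof. by have := Rle_abs a; have := Rle_abs (- a); rewrite Rabs_Ropp; lra. Qed.

Lemma RplusA : associative Rplus.
Proof. by move=> x y z; rewrite Rplus_assoc. Qed.

Lemma RmultA : associative Rmult.
Proof. by move=> x y z; rewrite Rmult_assoc. Qed.

HB.instance Definition _ :=
  Monoid.isComLaw.Build R 0 Rplus RplusA Rplus_comm Rplus_0_l.
HB.instance Definition _ :=
  Monoid.isComLaw.Build R 1 Rmult RmultA Rmult_comm Rmult_1_l.
HB.instance Definition _ := Monoid.isMulLaw.Build R 0 Rmult Rmult_0_l Rmult_0_r.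
HB.instance Definition _ :=
  Monoid.isAddLaw.Build R Rmult Rplus
    (fun x y z => Rmult_plus_distr_r x y z) (fun x y z => Rmult_plus_distr_l x y z).

Lemma le_bigRmax (I : finType) (F : I -> R) i : F i <= \big[Rmax/0]_(j : I) F j.
Proof.
have: i \in index_enum I by rewrite mem_index_enum.
elim: (index_enum I) => [|j r IH] //.
rewrite big_cons in_cons => /orP [/eqP <-|/IH h]; first exact: Rmax_l.
exact: Rle_trans h (Rmax_r _ _).
Qed.

Lemma bigRmax_le (I : finType) (F : I -> R) B :
  0 <= B -> (forall i, F i <= B) -> \big[Rmax/0]_(j : I) F j <= B.
Proof. by move=> B0 h; apply: (big_ind (fun x => x <= B)) => // x y; apply: Rmax_lub. Qed.

Lemma bigRmax_ge0 (I : finType) (F : I -> R) : 0 <= \big[Rmax/0]_(j : I) F j.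
Proof.
elim: (index_enum I) => [|j r IH]; first by rewrite big_nil; lra.
by rewrite big_cons; apply: Rle_trans IH (Rmax_r _ _).
Qed.

Lemma Rsum_le (I : finType) (P : pred I) (F G : I -> R) :
  (forall i, P i -> F i <= G i) ->
  \big[Rplus/0]_(i | P i) F i <= \big[Rplus/0]_(i | P i) G i.
Proof.
by move=> h; apply: (big_ind2 (fun x y => x <= y)) => // [|x1 x2 y1 y2 ? ?]; lra.
Qed.

Lemma Rsum_ge0 (I : finType) (P : pred I) (F : I -> R) :
  (forall i, P i -> 0 <= F i) -> 0 <= \big[Rplus/0]_(i | P i) F i.
Proof.
by move=> h; apply: (big_ind (fun x => 0 <= x)) => // [|x y ? ?]; lra.
Qed.

Lemma Rabs_Rsum (I : finType) (P : pred I) (F : I -> R) :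
  Rabs (\big[Rplus/0]_(i | P i) F i) <= \big[Rplus/0]_(i | P i) Rabs (F i).
Proof.
apply: (big_ind2 (fun x y => Rabs x <= y)) => [|x1 x2 y1 y2 h1 h2|i _].
- rewrite Rabs_R0; lra.
- apply: Rle_trans (Rabs_triang _ _) _; lra.
- lra.
Qed.

Lemma Rsum_mull (I : finType) (P : pred I) (F : I -> R) c :
  \big[Rplus/0]_(i | P i) (c * F i) = c * \big[Rplus/0]_(i | P i) F i.
Proof. by rewrite big_distrr. Qed.

Lemma Rsum_sub (I : finType) (P : pred I) (F G : I -> R) :
  \big[Rplus/0]_(i | P i) (F i - G i) =
  \big[Rplus/0]_(i | P i) F i - \big[Rplus/0]_(i | P i) G i.
Proof.
rewrite (eq_bigr (fun i => F i + -1 * G i)); last by move=> i _; lra.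
by rewrite big_split /= Rsum_mull; lra.
Qed.

Lemma Rsum_const (I : finType) (c : R) : \big[Rplus/0]_(i : I) c = INR #|I| * c.
Proof.
rewrite big_const; elim: #|I| => [|n IH]; first by rewrite /=; lra.
by rewrite iterS IH S_INR; lra.
Qed.

Lemma Rsum_ge_term (I : finType) (F : I -> R) i :
  (forall j, 0 <= F j) -> F i <= \big[Rplus/0]_(j : I) F j.
Proof.
move=> h; rewrite (bigD1 i) //=.
have := @Rsum_ge0 I (fun j => j != i) F (fun j _ => h j); lra.
Qed.

Lemma normv_ge {n} (x : vec n) i : Rabs (x i) <= normv x.
Proof. exact: (le_bigRmax _ (fun i => Rabs (x i))). Qed.

Lemma normv_ge0 {n} (x : vec n) : 0 <= normv x.
Proof. exact: bigRmax_ge0. Qed.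

Lemma normv_le {n} (x : vec n) B :
  0 <= B -> (forall i, Rabs (x i) <= B) -> normv x <= B.
Proof. exact: bigRmax_le. Qed.

(** * Derivatives and uniqueness for ordinary differential equations *)

Lemma derivable_pt_lim_eq f x l l' :
  derivable_pt_lim f x l -> l = l' -> derivable_pt_lim f x l'.
Proof. by move=> h <-. Qed.

Lemma derivable_pt_lim_affine f a b x l :
  derivable_pt_lim f (a * x + b) l ->
  derivable_pt_lim (fun s => f (a * s + b)) x (a * l).
Proof.
move=> h.
have ha : derivable_pt_lim (fun s => a * s + b) x a.
  apply: derivable_pt_lim_eq.
    apply: (derivable_pt_lim_plus (fun s => a * s) (fun=> b)).
      apply: (derivable_pt_lim_scal (fun s => s)); exact: derivable_pt_lim_id.
    exact: derivable_pt_lim_const.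
  lra.
have := derivable_pt_lim_comp _ _ _ _ _ ha h.
by rewrite Rmult_comm.
Qed.

Lemma derivable_pt_lim_Rsum (I : finType) (F : I -> R -> R) (F' : I -> R) x :
  (forall i, derivable_pt_lim (F i) x (F' i)) ->
  derivable_pt_lim (fun s => \big[Rplus/0]_(i : I) F i s) x
    (\big[Rplus/0]_(i : I) F' i).
Proof.
move=> h; elim: (index_enum I) => [|i r IH].
  rewrite big_nil.
  have -> : (fun s => \big[Rplus/0]_(i <- [::]) F i s) = fun=> 0.
    by apply: functional_extensionality => s; rewrite big_nil.
  exact: derivable_pt_lim_const.
rewrite big_cons.
have -> : (fun s => \big[Rplus/0]_(j <- i :: r) F j s) =
          (fun s => F i s + \big[Rplus/0]_(j <- r) F j s).
  by apply: functional_extensionality => s; rewrite big_cons.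
exact: derivable_pt_lim_plus.
Qed.

Lemma derivative_bound f f' B a b :
  (forall t, derivable_pt_lim f t (f' t)) -> (forall t, Rabs (f' t) <= B) ->
  Rabs (f b - f a) <= B * Rabs (b - a).
Proof.
move=> df hB.
have key u v : u < v -> Rabs (f v - f u) <= B * Rabs (v - u).
  move=> uv; have [c [-> _]] := MVT_cor2 f f' u v uv (fun c _ => df c).
  rewrite Rabs_mult; apply: Rmult_le_compat_r; [exact: Rabs_pos|exact: hB].
case: (Rtotal_order a b) => [/key //|[->|/key h]].
  by rewrite !Rminus_diag Rabs_R0; lra.
by rewrite (Rabs_minus_sym (f b)) (Rabs_minus_sym b).
Qed.

(** Gronwall in both directions of time: [S t * exp (K * t)] is nondecreasing, which carries the
    zero at [t0] to earlier times, and [S t * exp (- K * t)] is nonincreasing, which carries it to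
    later ones. *)
Lemma zero_of_growth_bound (S S' : R -> R) K t0 :
  (forall t, derivable_pt_lim S t (S' t)) -> (forall t, 0 <= S t) ->
  (forall t, Rabs (S' t) <= K * S t) -> S t0 = 0 -> forall t, S t = 0.
Proof.
move=> dS S0 hK St0 t.
have dh (b : R) s : derivable_pt_lim (fun s => S s * exp (b * s)) s
    ((S' s + b * S s) * exp (b * s)).
  apply: derivable_pt_lim_eq.
    apply: (derivable_pt_lim_mult S (fun s => exp (b * s))); first exact: dS.
    have -> : (fun s => exp (b * s)) = (fun s => exp (b * s + 0)).
      by apply: functional_extensionality => r; rewrite Rplus_0_r.
    apply: derivable_pt_lim_affine; exact: derivable_pt_lim_exp.
  rewrite Rplus_0_r; ring.
apply: Rle_antisym => //; apply: Rnot_lt_le => Spos.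
case: (Rtotal_order t0 t) => [lt|[e|lt]]; last 2 first.
- by subst; lra.
- have [c [hc _]] := MVT_cor2 _ _ _ _ lt (fun c _ => dh K c).
  rewrite St0 in hc.
  have h1 : 0 <= S' c + K * S c by have := hK c; case/Rabs_le_inv; lra.
  have := Rmult_le_pos _ _ h1 (Rlt_le _ _ (exp_pos (K * c))).
  have := Rmult_lt_0_compat _ _ Spos (exp_pos (K * t)); nra.
have [c [hc _]] := MVT_cor2 _ _ _ _ lt (fun c _ => dh (- K) c).
rewrite St0 in hc.
have h1 : 0 <= K * S c - S' c by have := hK c; case/Rabs_le_inv; lra.
have := Rmult_le_pos _ _ h1 (Rlt_le _ _ (exp_pos (- K * c))).
have := Rmult_lt_0_compat _ _ Spos (exp_pos (- K * t)); nra.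
Qed.

(** The squared Euclidean distance [S] of the two solutions is differentiable, unlike the max norm,
    and the Lipschitz condition bounds its derivative by a multiple of [S]. *)
Lemma ode_unique {n} (g : vec n -> R -> vec n) kappa (x y : R -> vec n) t0 :
  (forall a b t i, Rabs (g a t i - g b t i) <= kappa * normv (vsub a b)) ->
  (forall t i, derivable_pt_lim (fun s => x s i) t (g (x t) t i)) ->
  (forall t i, derivable_pt_lim (fun s => y s i) t (g (y t) t i)) ->
  x t0 = y t0 -> forall t, x t = y t.
Proof.
move=> lip dx dy e0 t.
pose w s i := x s i - y s i.
pose S s := \big[Rplus/0]_(i < n) (w s i * w s i).
pose S' s := \big[Rplus/0]_(i < n) (2 * w s i * (g (x s) s i - g (y s) s i)).
have ge0 s i : 0 <= w s i * w s i by nra.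
have dS s : derivable_pt_lim S s (S' s).
  apply: (derivable_pt_lim_Rsum _ (fun i s => w s i * w s i)) => i.
  have dw : derivable_pt_lim (w ^~ i) s (g (x s) s i - g (y s) s i).
    exact: (derivable_pt_lim_minus (fun s => x s i) (fun s => y s i)).
  apply: derivable_pt_lim_eq; first exact: (derivable_pt_lim_mult _ _ _ _ _ dw dw).
  by rewrite /w; ring.
have term s i : w s i * w s i <= S s by exact: (Rsum_ge_term _ (fun i => w s i * w s i)).
have S0 s : 0 <= S s by apply: Rsum_ge0.
have nS s : normv (w s) * normv (w s) <= S s.
  have : normv (w s) <= sqrt (S s).
    apply: normv_le => [|i]; first exact: sqrt_pos.
    apply: Rsqr_incr_0_var; last exact: sqrt_pos.
    by rewrite -Rsqr_abs Rsqr_sqrt //; apply: term.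
  have := sqrt_sqrt _ (S0 s); have := normv_ge0 (w s); have := sqrt_pos (S s); nra.
(* [Rabs kappa] occurs because no sign is assumed for [kappa]; the factor [INR n] counts the
   summands, each at most [2 * Rabs kappa * S s]. *)
have hS' s : Rabs (S' s) <= INR n * (2 * Rabs kappa) * S s.
  apply: Rle_trans (Rabs_Rsum _ _ _) _.
  have -> : INR n * (2 * Rabs kappa) * S s = \big[Rplus/0]_(i < n) (2 * Rabs kappa * S s).
    by rewrite Rsum_const card_ord; ring.
  apply: Rsum_le => i _; rewrite !Rabs_mult (Rabs_right 2); last lra.
  have h1 := normv_ge (w s) i.
  have h2 : Rabs (g (x s) s i - g (y s) s i) <= Rabs kappa * normv (w s).
    apply: Rle_trans (lip _ _ _ _) _; apply: Rmult_le_compat_r; first exact: normv_ge0.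
    exact: Rle_abs.
  have h3 := Rabs_pos (w s i).
  have h4 := Rmult_le_compat _ _ _ _ h3 (Rabs_pos _) h1 h2.
  have := Rmult_le_compat_l _ _ _ (Rabs_pos kappa) (nS s); lra.
have St0 : S t0 = 0.
  by apply: big1 => i _; rewrite /w e0; ring.
have St := zero_of_growth_bound S S' _ t0 dS S0 hS' St0 t.
apply: functional_extensionality => i.
have := term t i; rewrite St /w => h.
have : (x t i - y t i) * (x t i - y t i) = 0 by have := ge0 t i; rewrite /w; lra.
by move/Rmult_integral; lra.
Qed.

(* Every left endpoint [a - e] lies below every right endpoint, so their supremum is within all the tolerances. *)
Lemma common_approximation (P : R -> R -> Prop) :
  (exists a e, P a e) ->
  (forall a e b h, P a e -> P b h -> Rabs (a - b) <= e + h) ->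
  exists A, forall a e, P a e -> Rabs (A - a) <= e.
Proof.
move=> [a0 [e0 h0]] hP.
have [| |A [ub lub]] := completeness (fun x => exists a e, P a e /\ x = a - e).
- exists (a0 + e0) => x [a [e [h ->]]].
  by have := hP _ _ _ _ h h0; case/Rabs_le_inv; lra.
- by exists (a0 - e0), a0, e0.
exists A => a e h; apply: Rabs_le; split.
  have : a - e <= A by apply: ub; exists a, e.
  lra.
have : A <= a + e; last lra.
apply: lub => x [b [f [hb ->]]].
by have := hP _ _ _ _ h hb; case/Rabs_le_inv; lra.
Qed.

(** * Flows of periodic fields *)

(** Division by [m] in the limit: this is how bounded errors drop out of estimates along integer
    multiples. *)
Lemma nat_multiples_bounded_le0 a b : (forall m : nat, INR m * a <= b) -> a <= 0.
Proof.
move=> h; apply: Rnot_lt_le => a0.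
have [m hm] := INR_archimed a b a0.
by have := h m; lra.
Qed.

Lemma nat_floor t : 0 <= t -> exists m : nat, INR m <= t <= INR m + 1.
Proof.
move=> t0; exists (Z.to_nat (Int_part t)).
have [h1 h2] := base_Int_part t.
have h0 : (0 <= Int_part t)%Z.
  have : (-1 < Int_part t)%Z by apply: lt_IZR; lra.
  lia.
by rewrite INR_IZR_INZ Z2Nat.id //; lra.
Qed.

Lemma almost_additive_linear (a : nat -> R) b K :
  a 0%N = 0 -> (forall k, Rabs (a k.+1 - a k - b) <= K) ->
  forall k, Rabs (a k - INR k * b) <= INR k * K.
Proof.
move=> a0 h; elim=> [|k IH].
  by rewrite a0 /= Rmult_0_l Rminus_0_r Rabs_R0; lra.
rewrite S_INR.
have -> : a k.+1 - (INR k + 1) * b = (a k.+1 - a k - b) + (a k - INR k * b) by ring.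
apply: Rle_trans (Rabs_triang _ _) _; have := h k; lra.
Qed.

(** Cutting [k * m] steps into [k] blocks puts [d x (k * m)] within [k * K] of [k * d y m].
    Computing the displacement over [m * p] steps in two ways then puts the averages over [m] and
    over [p] steps within [K / m + K / p] of each other, so all of them approximate one number. *)
Lemma cocycle_rotation_number (X : Type) (x0 : X) (d : X -> nat -> R) (T : X -> nat -> X) K :
  (forall x, d x 0%N = 0) ->
  (forall x m p, d x (m + p)%N = d x m + d (T x m) p) ->
  (forall x y m, Rabs (d x m - d y m) <= K) ->
  exists xi, forall x m, Rabs (d x m - INR m * xi) <= K.
Proof.
move=> d0 dD osc.
have block x y m k : Rabs (d x (k * m)%N - INR k * d y m) <= INR k * K.
  apply: (almost_additive_linear (fun k => d x (k * m)%N)) => [|j]; first by rewrite mul0n.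
  have -> : (j.+1 * m)%N = (j * m + m)%N by rewrite mulSn addnC.
  rewrite dD.
  have -> : d x (j * m)%N + d (T x (j * m)%N) m - d x (j * m)%N - d y m =
            d (T x (j * m)%N) m - d y m by ring.
  exact: osc.
have pos m : 0 < INR m.+1 by apply: lt_0_INR; lia.
have [] := common_approximation
  (fun a e => exists x m, a = d x m.+1 / INR m.+1 /\ e = K / INR m.+1).
- by exists (d x0 1%N / INR 1), (K / INR 1), x0, 0%N.
- move=> _ _ _ _ [x [m [-> ->]]] [y [p [-> ->]]].
  have h1 := block x x m.+1 p.+1.
  have h2 := block x y p.+1 m.+1.
  rewrite mulnC in h2.
  have mp := Rmult_lt_0_compat _ _ (pos m) (pos p).
  apply: (Rmult_le_reg_l _ _ _ mp).
  rewrite -{1}(Rabs_right (INR m.+1 * INR p.+1)); last lra.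
  rewrite -Rabs_mult.
  have -> : INR m.+1 * INR p.+1 * (d x m.+1 / INR m.+1 - d y p.+1 / INR p.+1) =
     (d x (p.+1 * m.+1)%N - INR m.+1 * d y p.+1) - (d x (p.+1 * m.+1)%N - INR p.+1 * d x m.+1).
    by field; have := pos m; have := pos p; lra.
  apply: Rle_trans (Rabs_triang _ _) _; rewrite Rabs_Ropp.
  have -> : INR m.+1 * INR p.+1 * (K / INR m.+1 + K / INR p.+1) =
     INR m.+1 * K + INR p.+1 * K.
    by field; have := pos m; have := pos p; lra.
  lra.
move=> xi h; exists xi => x [|m].
  rewrite d0 /= Rmult_0_l Rminus_0_r Rabs_R0.
  by apply: Rle_trans (Rabs_pos _) (osc x x 0%N).
have := h _ _ (ex_intro _ x (ex_intro _ m (conj erefl erefl))).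
have pm := pos m => h1.
have -> : d x m.+1 - INR m.+1 * xi = - (INR m.+1 * (xi - d x m.+1 / INR m.+1)) by field; lra.
rewrite Rabs_Ropp Rabs_mult (Rabs_right (INR m.+1)); last lra.
have -> : K = INR m.+1 * (K / INR m.+1) by field; lra.
apply: Rmult_le_compat_l => //; lra.
Qed.

Section PeriodicFlow.
Context {n : nat} (f : vec n -> R -> vec n) (kappa : R) (v : vec n -> R -> vec n).
Hypothesis f_lip : lipschitz_rt f kappa.
Hypothesis f_per : periodic_rt f.
Hypothesis v_flow : is_flow f v.

Lemma lipschitz_in_space a b t i : Rabs (f a t i - f b t i) <= kappa * normv (vsub a b).
Proof.
by have := f_lip a b t t i; rewrite Rminus_diag Rabs_R0 Rmax_left //; apply: normv_ge0.
Qed.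

Lemma flow_ext (c : vec n) (y : R -> vec n) :
  (forall t i, derivable_pt_lim (fun s => y s i) t (f (y t) t i)) ->
  y 0 = c -> forall t, y t = v c t.
Proof.
move=> dy y0.
apply: (ode_unique f kappa _ _ 0 lipschitz_in_space dy); first by have [] := v_flow c.
by rewrite y0; have [-> _] := v_flow c.
Qed.

(** The shifted curve solves the same equation, as [s0] is a period of the field. The period is
    arbitrary, so that the statement serves integer times and autonomous fields alike. *)
Lemma flow_time_shift s0 c s :
  (forall r tau, f r (tau + s0) = f r tau) -> v c (s0 + s) = v (v c s0) s.
Proof.
move=> per; apply: (flow_ext _ (fun s => v c (s0 + s))) => [t i|]; last by rewrite Rplus_0_r.
have -> : (fun s => v c (s0 + s) i) = (fun s => v c (1 * s + s0) i).
  by apply: functional_extensionality => r; congr (v c _ i); ring.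
apply: derivable_pt_lim_eq.
  by apply: (derivable_pt_lim_affine (fun s => v c s i)); have [_] := v_flow c; apply.
by rewrite !Rmult_1_l per Rplus_comm.
Qed.

Lemma flow_integer_time m c s : v c (INR m + s) = v (v c (INR m)) s.
Proof.
apply: flow_time_shift => r tau.
rewrite INR_IZR_INZ -[in RHS](f_per r tau (fun=> 0%Z) (Z.of_nat m)).
by congr f; apply: functional_extensionality => i; rewrite Rplus_0_r.
Qed.

Lemma flow_space_shift (k : 'I_n -> Z) c s :
  v (fun i => c i + IZR (k i)) s = fun i => v c s i + IZR (k i).
Proof.
symmetry; apply: (flow_ext _ (fun s i => v c s i + IZR (k i))) => [t i|]; last first.
  by have [-> _] := v_flow c.
have e := f_per (v c t) t k 0%Z; rewrite Rplus_0_r in e; rewrite e.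
apply: derivable_pt_lim_eq.
  apply: (derivable_pt_lim_plus (fun s => v c s i) (fun=> IZR (k i))).
    by have [_] := v_flow c; apply.
  exact: derivable_pt_lim_const.
by rewrite Rplus_0_r.
Qed.

Let disp c t i := v c t i - c i.

Lemma displacement_le M c t i :
  (forall r tau, Rabs (f r tau i) <= M) -> 0 <= t -> Rabs (disp c t i) <= M * t.
Proof.
move=> hM t0.
have := derivative_bound (fun s => v c s i) (fun s => f (v c s) s i) M 0 t.
have [v0 dv] := v_flow c.
rewrite v0 Rminus_0_r (Rabs_right t); last lra.
by apply.
Qed.

Variable C0 : R.
Hypothesis C0_ge0 : 0 <= C0.
Hypothesis flow_bound : forall (i : 'I_n) tau (c1 c2 : vec n), 0 < tau ->
  (forall j, 0 <= c1 j - c2 j <= 1) -> v c2 tau i - v c1 tau i <= C0.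

(** The displacement is invariant under integer translations of the starting point, so one of the
    two points may be moved until their difference lies in the unit cell. The cell contributes [1],
    the bound on the flow [C0]. *)
Lemma displacement_osc c1 c2 t i : 0 <= t ->
  Rabs (disp c1 t i - disp c2 t i) <= 1 + C0.
Proof.
have half a b : 0 < t -> disp b t i - disp a t i <= 1 + C0.
  (* [up x] lies in [(x, x + 1]], so every coordinate of [a + k - b] lies in [(0, 1]]. *)
  move=> t0; pose k j := up (b j - a j).
  have hk j := archimed (b j - a j).
  have := flow_bound i t (fun j => a j + IZR (k j)) b t0.
  rewrite flow_space_shift /disp => h.
  have {}h := h _; have [_ h2] := hk i.
  have : v b t i - (v a t i + IZR (k i)) <= C0.
    by apply: h => j; have := hk j; rewrite /k; lra.
  by rewrite /k; lra.
case=> [t0|<-].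
  by apply: Rabs_le; have := half c1 c2 t0; have := half c2 c1 t0; lra.
rewrite /disp; have [-> _] := v_flow c1; have [-> _] := v_flow c2.
by rewrite !Rminus_diag Rabs_R0; lra.
Qed.

Lemma rotation_vector : exists xi : vec n, forall c m i,
  Rabs (disp c (INR m) i - INR m * xi i) <= 1 + C0.
Proof.
have h (i : 'I_n) : exists xi, forall c m, Rabs (disp c (INR m) i - INR m * xi) <= 1 + C0.
  apply: (cocycle_rotation_number _ (fun=> 0) (fun c m => disp c (INR m) i)
           (fun c m => v c (INR m))) => [c|c m p|c1 c2 m].
  - by rewrite /disp; have [-> _] := v_flow c; lra.
  - by rewrite /disp plus_INR flow_integer_time; ring.
  - by apply: displacement_osc; apply: pos_INR.
exists (fun i => proj1_sig (constructive_indefinite_description _ (h i))) => c m i.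
exact: (proj2_sig (constructive_indefinite_description _ (h i))) c m.
Qed.

Lemma rotation_bound : exists xi : vec n, forall c i M,
  (forall r tau, Rabs (f r tau i) <= M) ->
  forall t, 0 <= t -> Rabs (disp c t i - t * xi i) <= 1 + C0 + 2 * M.
Proof.
have [xi hxi] := rotation_vector; exists xi => c i M hM t t0.
have [m hm] := nat_floor t t0.
have M0 : 0 <= M by apply: Rle_trans (Rabs_pos _) (hM (fun=> 0) 0).
(* The slope inherits the bound of the field: at time [k] the displacement is at most [M * k] and
   within [1 + C0] of [k * xi i]. *)
have xiM : Rabs (xi i) <= M.
  suff : Rabs (xi i) - M <= 0 by lra.
  apply: (nat_multiples_bounded_le0 _ (1 + C0)) => k.
  have h1 := hxi c k i.
  have h2 := displacement_le M c _ i hM (pos_INR k).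
  have -> : INR k * (Rabs (xi i) - M) = Rabs (INR k * xi i) - M * INR k.
    by rewrite Rabs_mult (Rabs_right (INR k)); [ring|apply/Rle_ge/pos_INR].
  have := Rabs_triang_inv (INR k * xi i) (disp c (INR k) i).
  by rewrite Rabs_minus_sym; lra.
(* The whole periods cost [1 + C0]; over the remaining fraction the displacement and its linear
   model each move by at most [M]. *)
have -> : disp c t i - t * xi i = (disp c (INR m) i - INR m * xi i) +
    (disp (v c (INR m)) (t - INR m) i - (t - INR m) * xi i).
  rewrite /disp -flow_integer_time.
  have -> : INR m + (t - INR m) = t by ring.
  by ring.
apply: Rle_trans (Rabs_triang _ _) _.
have := hxi c m i.
have s0 : 0 <= t - INR m by lra.
have := displacement_le M (v c (INR m)) _ i hM s0.
have := Rabs_triang (disp (v c (INR m)) (t - INR m) i) (- ((t - INR m) * xi i)).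
rewrite Rabs_Ropp Rabs_mult (Rabs_right (t - INR m)); last lra.
have : (t - INR m) * Rabs (xi i) <= 1 * M.
  by have := Rabs_pos (xi i) => ?; apply: Rmult_le_compat; lra.
have : M * (t - INR m) <= M * 1 by apply: Rmult_le_compat_l; lra.
rewrite /Rminus; lra.
Qed.

(* For an autonomous field every [t] is a period, so the [2 M] lost on the fractional part of a large multiple of [t] averages out. *)
Lemma rotation_bound_autonomous (xi : vec n) B c i t :
  (forall r tau tau', f r tau = f r tau') ->
  (forall t, 0 <= t -> Rabs (disp c t i - t * xi i) <= B) ->
  0 <= t -> Rabs (disp c t i - t * xi i) <= 1 + C0.
Proof.
move=> aut hB t0.
have block k : Rabs (disp c (INR k * t) i - INR k * disp c t i) <= INR k * (1 + C0).
  apply: (almost_additive_linear (fun k => disp c (INR k * t) i)) => [|j].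
    by rewrite /disp /= Rmult_0_l; have [-> _] := v_flow c; ring.
  have -> : disp c (INR j.+1 * t) i - disp c (INR j * t) i - disp c t i =
     disp (v c (INR j * t)) t i - disp c t i.
    rewrite /disp -flow_time_shift => [|r tau]; last exact: aut.
    by rewrite S_INR Rmult_plus_distr_r Rmult_1_l; ring.
  exact: displacement_osc.
suff : Rabs (disp c t i - t * xi i) - (1 + C0) <= 0 by lra.
apply: (nat_multiples_bounded_le0 _ B) => k.
have h1 := block k.
have k0 := pos_INR k.
have h2 := hB (INR k * t) (Rmult_le_pos _ _ k0 t0).
have -> : INR k * (Rabs (disp c t i - t * xi i) - (1 + C0)) =
  Rabs (INR k * (disp c t i - t * xi i)) - INR k * (1 + C0).
  by rewrite Rabs_mult (Rabs_right (INR k)); [ring|apply/Rle_ge].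
have -> : INR k * (disp c t i - t * xi i) = (disp c (INR k * t) i - INR k * t * xi i) -
   (disp c (INR k * t) i - INR k * disp c t i) by ring.
have := Rabs_triang (disp c (INR k * t) i - INR k * t * xi i)
  (- (disp c (INR k * t) i - INR k * disp c t i)).
rewrite Rabs_Ropp /Rminus; rewrite /Rminus in h1 h2; lra.
Qed.

End PeriodicFlow.

(** * Rescaling by [eps], and the scalar case *)

Lemma rescaled_flow {n} (f : vec n -> R -> vec n) u eps : 0 < eps ->
  is_flow (fun x t => f (vscale (/ eps) x) (t / eps)) u ->
  is_flow f (fun c tau => vscale (/ eps) (u (vscale eps c) (eps * tau))).
Proof.
move=> e0 hu c; split=> [|t i].
  rewrite Rmult_0_r; have [-> _] := hu (vscale eps c).
  by apply: functional_extensionality => i; rewrite /vscale; field; lra.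
have [_ du] := hu (vscale eps c).
apply: derivable_pt_lim_eq.
  apply: (derivable_pt_lim_scal (fun s => u (vscale eps c) (eps * s) i)).
  have -> : (fun s => u (vscale eps c) (eps * s) i) =
            (fun s => u (vscale eps c) (eps * s + 0) i).
    by apply: functional_extensionality => s; rewrite Rplus_0_r.
  by apply: (derivable_pt_lim_affine (fun s => u (vscale eps c) s i)); apply: du.
rewrite Rplus_0_r.
have -> : eps * t / eps = t by field; lra.
by field; lra.
Qed.

(** Every [eps] leads back to the same flow of [f], hence [xi] is chosen before [eps]. Both
    estimates are stated together so that they share one [xi]. *)
Lemma flow_homogenization {n} (f : vec n -> R -> vec n) kappa C0 (M : vec n) :
  lipschitz_rt f kappa -> periodic_rt f -> 0 <= C0 ->
  (forall v, is_flow f v -> forall (i : 'I_n) tau (c1 c2 : vec n), 0 < tau ->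
     (forall j, 0 <= c1 j - c2 j <= 1) -> v c2 tau i - v c1 tau i <= C0) ->
  (forall r tau i, Rabs (f r tau i) <= M i) ->
  exists xi : vec n, forall eps, 0 < eps ->
    forall u, is_flow (fun x t => f (vscale (/ eps) x) (t / eps)) u ->
    forall t x0 i, 0 < t ->
      Rabs (x0 i - vdrift (u x0 t) xi t i) <= (1 + C0 + 2 * M i) * eps /\
      ((forall r tau tau', f r tau = f r tau') ->
        Rabs (x0 i - vdrift (u x0 t) xi t i) <= (1 + C0) * eps).
Proof.
move=> lip per C00 bnd hM.
have [[v hv]|nov] := classic (exists v, is_flow f v); last first.
  exists (fun=> 0) => eps e0 u /(rescaled_flow f u eps e0) hv.
  by case: nov; eexists; exact: hv.
have [xi hxi] := rotation_bound f kappa v lip per hv C0 C00 (bnd v hv).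
exists xi => eps e0 u hu t x0 i t0.
have t1 : 0 <= t / eps by apply: Rlt_le; apply: Rdiv_lt_0_compat.
have hw := rescaled_flow f u eps e0 hu.
pose c := vscale (/ eps) x0.
have e : v c (t / eps) = vscale (/ eps) (u x0 t).
  (* Uniqueness identifies the rescaling of an arbitrary [u] with the flow [v] from which [xi] was
     obtained. *)
  rewrite -(flow_ext f kappa v lip hv c _ (proj2 (hw c)) (proj1 (hw c))).
  congr (vscale _ (u _ _)); last by field; lra.
  by apply: functional_extensionality => j; rewrite /c /vscale; field; lra.
have -> : x0 i - vdrift (u x0 t) xi t i = - (eps * (v c (t / eps) i - c i - t / eps * xi i)).
  by rewrite e /vdrift /c /vscale; field; lra.
rewrite Rabs_Ropp Rabs_mult (Rabs_right eps); last lra.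
have hM' r tau := hM r tau i.
have hB s s0 := hxi c i (M i) hM' s s0.
split=> [|aut]; rewrite Rmult_comm; apply: Rmult_le_compat_r; try lra.
  exact: hB.
by apply: (rotation_bound_autonomous f kappa v lip per hv C0 C00 (bnd v hv) xi
             (1 + C0 + 2 * M i)).
Qed.

(** Trajectories that exchange their order meet at some time by the intermediate value theorem, and
    then coincide by uniqueness. *)
Lemma scalar_flow_monotone (f : vec 1 -> R -> vec 1) kappa v :
  lipschitz_rt f kappa -> is_flow f v ->
  forall (c1 c2 : vec 1) i tau, 0 < tau -> c2 i <= c1 i -> v c2 tau i <= v c1 tau i.
Proof.
move=> lip hv c1 c2 i tau tau0 le; apply: Rnot_lt_le => lt.
have [v1 d1] := hv c1; have [v2 d2] := hv c2.
pose g s := v c1 s i - v c2 s i.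
have cg : continuity g.
  move=> s; apply: derivable_continuous_pt; eexists.
  exact: (derivable_pt_lim_minus (fun s => v c1 s i) (fun s => v c2 s i) s _ _ (d1 s i) (d2 s i)).
have [||z [_ gz]] := IVT_cor g 0 tau cg; first lra.
  rewrite /g v1 v2; nra.
have e : v c1 z = v c2 z.
  apply: functional_extensionality => j.
  by rewrite (ord1 j) -(ord1 i); rewrite /g in gz; lra.
have := ode_unique f kappa _ _ z (lipschitz_in_space f kappa lip) d1 d2 e tau.
by move=> e'; rewrite e' in lt; lra.
Qed.

Lemma lipschitz_bound {n} (phi : vec n -> R) L x y B :
  lipschitz phi L -> 0 <= B -> (forall i, Rabs (x i - y i) <= B) ->
  Rabs (phi x - phi y) <= L * B.
Proof.
move=> [L0 h] B0 hB; apply: Rle_trans (h x y) _.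
by apply: Rmult_le_compat_l => //; apply: normv_le.
Qed.

Lemma normv1 (x : vec 1) : normv x = Rabs (x ord0).
Proof.
apply: Rle_antisym; last exact: normv_ge.
by apply: normv_le => [|i]; [exact: Rabs_pos|rewrite (ord1 i); lra].
Qed.

(** The scalar field is read as a field on one-dimensional vectors; monotonicity of its flow
    supplies the cell bound with [C0 = 0]. *)
Lemma scalar_flow_homogenization (f : R -> R -> R) kappa M :
  lipschitz_rt1 f kappa -> periodic_rt1 f -> (forall r tau, Rabs (f r tau) <= M) ->
  exists xi, forall eps, 0 < eps ->
    forall u, is_flow1 (fun x t => f (x / eps) (t / eps)) u ->
    forall t x0, 0 < t ->
      Rabs (x0 - (u x0 t - xi * t)) <= (1 + 2 * M) * eps /\
      ((forall r tau tau', f r tau = f r tau') ->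
        Rabs (x0 - (u x0 t - xi * t)) <= eps).
Proof.
move=> lip per hM.
pose g (r : vec 1) tau : vec 1 := fun=> f (r ord0) tau.
have glip : lipschitz_rt g kappa.
  by move=> r r' tau tau' i; rewrite normv1; apply: lip.
have [] := flow_homogenization g kappa 0 (fun=> M) glip.
- by move=> r tau k k0; apply: functional_extensionality => i; apply: per.
- lra.
- move=> v hv i tau c1 c2 tau0 hc.
  suff : v c2 tau i <= v c1 tau i by lra.
  by apply: scalar_flow_monotone => //; have := hc i; lra.
- by move=> r tau i; apply: hM.
move=> xi hxi; exists (xi ord0) => eps e0 u hu t x0 t0.
pose w (c : vec 1) s : vec 1 := fun=> u (c ord0) s.
have hw : is_flow (fun x t => g (vscale (/ eps) x) (t / eps)) w.
  move=> c; have [u0 du] := hu (c ord0); split=> [|s i].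
    by apply: functional_extensionality => i; rewrite /w u0 (ord1 i).
  apply: derivable_pt_lim_eq; first exact: du.
  by rewrite /g /vscale /w /Rdiv (Rmult_comm (/ eps)).
have [h1 h2] := hxi eps e0 w hw t (fun=> x0) ord0 t0.
split=> [|aut]; first by move: h1; rewrite Rplus_0_r.
have : (1 + 0) * eps = eps by ring.
by move=> <-; apply: h2 => r tau tau'; apply: functional_extensionality => i; apply: aut.
Qed.

(** * Functions on the torus *)

Lemma vupd_same {d} (x : vec d) i : vupd x i (x i) = x.
Proof. by apply: functional_extensionality => j; rewrite /vupd; case: eqP => [->|]. Qed.

Lemma vupd_vupd {d} (x : vec d) i s t : vupd (vupd x i s) i t = vupd x i t.
Proof. by apply: functional_extensionality => j; rewrite /vupd; case: eqP. Qed.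

Lemma vupd_at {d} (x : vec d) i s : vupd x i s i = s.
Proof. by rewrite /vupd eqxx. Qed.

Definition partial {d} (i : 'I_d) (G G' : vec d -> R) :=
  forall x, derivable_pt_lim (fun s => G (vupd x i s)) (x i) (G' x).

Lemma partial_line {d} (i : 'I_d) (G G' : vec d -> R) x s :
  partial i G G' -> derivable_pt_lim (fun s => G (vupd x i s)) s (G' (vupd x i s)).
Proof.
move=> h; have := h (vupd x i s); rewrite vupd_at.
have -> // : (fun t => G (vupd (vupd x i s) i t)) = (fun t => G (vupd x i t)).
by apply: functional_extensionality => t; rewrite vupd_vupd.
Qed.

Lemma partial_periodic {d} (i : 'I_d) (G G' : vec d -> R) :
  partial i G G' -> periodic_v G -> periodic_v G'.
Proof.
move=> dG per z k.
apply: (uniqueness_limite _ _ _ _ (dG (fun j => z j + IZR (k j)))).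
have -> : (fun s => G (vupd (fun j => z j + IZR (k j)) i s)) =
          (fun s => G (vupd z i (1 * s + - IZR (k i)))).
  apply: functional_extensionality => s.
  rewrite -(per (vupd z i _) k); congr G; apply: functional_extensionality => j.
  by rewrite /vupd; case: eqP => [->|_] //; ring.
apply: derivable_pt_lim_eq.
  apply: (derivable_pt_lim_affine (fun s => G (vupd z i s))).
  exact: partial_line.
have -> : 1 * (z i + IZR (k i)) + - IZR (k i) = z i by ring.
by rewrite vupd_same Rmult_1_l.
Qed.

(** * Stability of [Cm] under sums, products and inverses *)

Lemma partial_mult {d} (i : 'I_d) (A A' B B' : vec d -> R) :
  partial i A A' -> partial i B B' ->
  partial i (fun z => A z * B z) (fun z => A' z * B z + A z * B' z).
Proof.
move=> dA dB x; apply: derivable_pt_lim_eq.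
  exact: (derivable_pt_lim_mult _ _ _ _ _ (dA x) (dB x)).
by rewrite /= vupd_same.
Qed.

Lemma partial_inv {d} (i : 'I_d) (A A' : vec d -> R) : (forall z, A z > 0) ->
  partial i A A' -> partial i (fun z => / A z) (fun z => -1 * (A' z * (/ A z * / A z))).
Proof.
move=> A0 dA x; have A0x := A0 x; apply: derivable_pt_lim_eq.
  have -> : (fun s => / A (vupd x i s)) = (fun s => 1 / A (vupd x i s)).
    by apply: functional_extensionality => s; rewrite /Rdiv Rmult_1_l.
  apply: (derivable_pt_lim_div (fun=> 1) (fun s => A (vupd x i s)) _ 0).
  - exact: derivable_pt_lim_const.
  - exact: dA.
  - by rewrite /= vupd_same; lra.
by rewrite /= vupd_same /Rsqr; field; lra.
Qed.

Lemma continuous_v_add {d} (A B : vec d -> R) :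
  continuous_v A -> continuous_v B -> continuous_v (fun z => A z + B z).
Proof.
move=> cA cB x e e0.
have [a [a0 ha]] := cA x (e / 2) ltac:(lra); have [b [b0 hb]] := cB x (e / 2) ltac:(lra).
exists (Rmin a b); split=> [|y hy]; first exact: Rmin_pos.
have := ha y (Rlt_le_trans _ _ _ hy (Rmin_l _ _)).
have := hb y (Rlt_le_trans _ _ _ hy (Rmin_r _ _)).
have -> : A y + B y - (A x + B x) = (A y - A x) + (B y - B x) by ring.
have := Rabs_triang (A y - A x) (B y - B x); lra.
Qed.

Lemma continuous_v_mult {d} (A B : vec d -> R) :
  continuous_v A -> continuous_v B -> continuous_v (fun z => A z * B z).
Proof.
move=> cA cB x e e0.
have pA := Rabs_pos (A x); have pB := Rabs_pos (B x).
pose D := 1 + Rabs (A x) + Rabs (B x).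
have [u0 [u1 uD]] : 0 < Rmin 1 (e / D) /\ Rmin 1 (e / D) <= 1 /\ Rmin 1 (e / D) * D <= e.
  have eD : 0 < e / D by apply: Rdiv_lt_0_compat => //; rewrite /D; lra.
  split; first by apply: Rmin_pos => //; lra.
  split; first exact: Rmin_l.
  apply: (Rle_trans _ (e / D * D)); last by apply: Req_le; field; rewrite /D; lra.
  by apply: Rmult_le_compat_r; [rewrite /D; lra|exact: Rmin_r].
set u := Rmin _ _ in u0 u1 uD.
have [a [a0 ha]] := cA x u u0; have [b [b0 hb]] := cB x u u0.
exists (Rmin a b); split=> [|y hy]; first exact: Rmin_pos.
have {}ha := ha y (Rlt_le_trans _ _ _ hy (Rmin_l _ _)).
have {}hb := hb y (Rlt_le_trans _ _ _ hy (Rmin_r _ _)).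
have -> : A y * B y - A x * B x =
  (A y - A x) * (B y - B x) + (A x * (B y - B x) + B x * (A y - A x)) by ring.
apply: Rle_lt_trans (Rabs_triang _ _) _.
apply: Rle_lt_trans (Rplus_le_compat_l _ _ _ (Rabs_triang _ _)) _.
rewrite !Rabs_mult.
have p0 := Rabs_pos (A y - A x); have q0 := Rabs_pos (B y - B x).
have h1 := Rmult_le_compat_l _ _ _ pA (Rlt_le _ _ hb).
have h2 := Rmult_le_compat_l _ _ _ pB (Rlt_le _ _ ha).
have h3 := Rmult_le_compat_l _ _ _ p0 (Rle_trans _ _ _ (Rlt_le _ _ hb) u1).
rewrite /D in uD; lra.
Qed.

Lemma continuous_v_inv {d} (A : vec d -> R) : (forall z, A z > 0) ->
  continuous_v A -> continuous_v (fun z => / A z).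
Proof.
move=> A0 cA x e e0; have Ax := A0 x.
pose u := Rmin (A x / 2) (e * (A x * A x) / 2).
have eA : 0 < e * (A x * A x) by apply: Rmult_lt_0_compat => //; nra.
have u0 : 0 < u by apply: Rmin_pos; lra.
have [a [a0 ha]] := cA x u u0; exists a; split=> // y hy.
have Ay := A0 y; have {}ha := ha y hy.
have h1 := Rlt_le_trans _ _ _ ha (Rmin_l _ _).
have h2 := Rlt_le_trans _ _ _ ha (Rmin_r _ _).
have h3 : A x / 2 < A y by have := Rabs_def2 _ _ h1; lra.
have h4 : 0 < A y * A x by nra.
have -> : / A y - / A x = - ((A y - A x) / (A y * A x)) by field; lra.
rewrite Rabs_Ropp /Rdiv Rabs_mult Rabs_inv (Rabs_right (A y * A x)); last lra.
apply: (Rmult_lt_reg_r (A y * A x)) => //.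
rewrite Rmult_assoc Rinv_l; last lra.
have : e * (A x * A x) / 2 < e * (A y * A x) by nra.
lra.
Qed.

Lemma Cm_continuous {d} m (F : vec d -> R) : Cm m F -> continuous_v F.
Proof. by case: m => [|m] // []. Qed.

Lemma Cm_pred {d} m (F : vec d -> R) : Cm m.+1 F -> Cm m F.
Proof.
elim: m F => [|m IH] F [c h] //; split=> // i.
by have [G [dG hG]] := h i; exists G; split=> //; apply: IH.
Qed.

Lemma Cm_const {d} m c : Cm m (fun _ : vec d => c).
Proof.
elim: m c => [|m IH] c.
  by move=> x e e0; exists 1; split=> [|y _]; [lra|rewrite Rminus_diag Rabs_R0].
split=> [x e e0|i]; first by exists 1; split=> [|y _]; [lra|rewrite Rminus_diag Rabs_R0].
by exists (fun=> 0); split=> // x; apply: derivable_pt_lim_const.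
Qed.

Lemma Cm_add {d} m (A B : vec d -> R) : Cm m A -> Cm m B -> Cm m (fun z => A z + B z).
Proof.
elim: m A B => [|m IH] A B; first exact: continuous_v_add.
move=> [cA hA] [cB hB]; split=> [|i]; first exact: continuous_v_add.
have [A' [dA hA']] := hA i; have [B' [dB hB']] := hB i.
exists (fun z => A' z + B' z); split=> [x|]; last exact: IH.
exact: (derivable_pt_lim_plus _ _ _ _ _ (dA x) (dB x)).
Qed.

Lemma Cm_mult {d} m (A B : vec d -> R) : Cm m A -> Cm m B -> Cm m (fun z => A z * B z).
Proof.
elim: m A B => [|m IH] A B; first exact: continuous_v_mult.
move=> HA HB; split=> [|i].
  by apply: continuous_v_mult; apply: Cm_continuous; eassumption.
have [A' [dA hA']] := (proj2 HA) i; have [B' [dB hB']] := (proj2 HB) i.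
exists (fun z => A' z * B z + A z * B' z); split; first exact: partial_mult.
by apply: Cm_add; apply: IH => //; apply: Cm_pred.
Qed.

(** The partial derivative [- A' / A ^ 2] is a product of functions that are [Cm] by induction. The
    lemma is applied to [1 / F]. *)
Lemma Cm_inv {d} m (A : vec d -> R) : (forall z, A z > 0) ->
  Cm m A -> Cm m (fun z => / A z).
Proof.
move=> A0; elim: m => [|m IH]; first exact: continuous_v_inv.
move=> HA; split=> [|i]; first by apply: continuous_v_inv => //; apply: Cm_continuous HA.
have [A' [dA hA']] := (proj2 HA) i.
exists (fun z => -1 * (A' z * (/ A z * / A z))); split; first exact: partial_inv.
have hi := IH (Cm_pred _ _ HA).
by apply: Cm_mult; [exact: Cm_const|apply: Cm_mult => //; apply: Cm_mult].
Qed.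

(** * Boundedness by compactness of the unit cube *)

(** Coquelicot states compactness of boxes for nested pairs [Tn n R]; [coord] and [tabulate]
    translate between these and sequences. *)
Fixpoint coord n : Compactness.Tn n R -> nat -> R :=
  match n with
  | O => fun _ _ => 0
  | S n' => fun t k => match k with O => t.1 | S k' => coord n' t.2 k' end
  end.

Fixpoint tabulate n (x : nat -> R) : Compactness.Tn n R :=
  match n with
  | O => tt
  | S n' => (x O, tabulate n' (fun k => x (S k)))
  end.

Lemma coord_tabulate n x k : (k < n)%N -> coord n (tabulate n x) k = x k.
Proof. by elim: n x k => [|n IH] x [|k] //= h; rewrite IH. Qed.

Lemma bounded_tabulate n x : (forall k, 0 <= x k <= 1) ->
  Compactness.bounded_n n (tabulate n (fun=> 0)) (tabulate n (fun=> 1)) (tabulate n x).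
Proof.
elim: n x => [|n IH] x h //=; split; first exact: h.
by apply: IH => k; apply: h.
Qed.

Lemma close_coord n e s t k : (k < n)%N -> Compactness.close_n n e s t ->
  Rabs (coord n s k - coord n t k) < e.
Proof.
elim: n s t k => [|n IH] s t k //; case: s t k => s1 s2 [t1 t2] [|k] /= h [h1 h2] //.
exact: IH.
Qed.

Lemma periodic_unit_cube {d} (z : vec d) : exists (z' : vec d) (k : 'I_d -> Z),
  (forall i, 0 <= z' i < 1) /\ z = fun i => z' i + IZR (k i).
Proof.
exists (fun i => z i - IZR (Int_part (z i))), (fun i => Int_part (z i)); split=> [i|].
  by have := base_Int_part (z i); lra.
by apply: functional_extensionality => i; ring.
Qed.

(** Periodicity reduces to the unit cube, which is covered by finitely many balls on each of which
    [F] stays within [1] of its value at the centre. *)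
Lemma periodic_continuous_bounded {d} (F : vec d -> R) :
  continuous_v F -> periodic_v F -> exists B, forall z, Rabs (F z) <= B.
Proof.
move=> cF per.
pose vec_of (t : Compactness.Tn d R) : vec d := fun i => coord d t i.
have hdelta t : exists e : posreal, forall y, normv (vsub y (vec_of t)) < e ->
    Rabs (F y - F (vec_of t)) < 1.
  have [e [e0 he]] := cF (vec_of t) 1 Rlt_0_1.
  by exists (mkposreal e e0).
pose delta t := proj1_sig (constructive_indefinite_description _ (hdelta t)).
have hd t : forall y, normv (vsub y (vec_of t)) < delta t -> Rabs (F y - F (vec_of t)) < 1.
  exact: proj2_sig (constructive_indefinite_description _ (hdelta t)).
(* Passing to the max norm turns the strict coordinate bounds into a weak one; half the radius
   restores strictness. *)
pose half t : posreal := 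
  mkposreal (delta t / 2) (Rdiv_lt_0_compat _ _ (cond_pos (delta t)) Rlt_0_2).
have [l hl] := NNPP _ (Compactness.compactness_list d (tabulate d (fun=> 0))
                         (tabulate d (fun=> 1)) half).
have [B hB] : exists B, forall t, List.In t l -> Rabs (F (vec_of t)) <= B.
  elim: {hl} l => [|t l [B hB]]; first by exists 0.
  exists (Rmax B (Rabs (F (vec_of t)))) => s /= [<-|/hB h]; first exact: Rmax_r.
  exact: Rle_trans h (Rmax_l _ _).
exists (B + 1) => z.
have [z' [k [hz ->]]] := periodic_unit_cube z; rewrite per.
(* The default [0] for indices beyond [d] keeps the tabulated point in the cube. *)
pose x k := if insub k is Some i then z' i else 0.
have hx i : x (nat_of_ord i) = z' i by rewrite /x valK.
have [k'|t [tl [_ ht]]] := hl (tabulate d x) (bounded_tabulate _ _ _).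
  rewrite /x; case: insub => [i|]; [by have := hz i; lra|lra].
have : Rabs (F z' - F (vec_of t)) < 1.
  apply: hd; have dp := cond_pos (delta t).
  apply: (Rle_lt_trans _ (delta t / 2)); last lra.
  apply: normv_le => [|i]; first lra.
  have := close_coord _ _ _ _ i (ltn_ord i) ht.
  by rewrite coord_tabulate // hx /vsub /vec_of /=; lra.
have := hB t tl; have := Rabs_triang_inv (F z') (F (vec_of t)); lra.
Qed.

(** * Bounded pure derivatives and finite differences *)

(** Only repeated derivatives in a single coordinate: the decay of a Fourier coefficient is read off
    in the coordinate where its frequency is largest. *)
Fixpoint partial_pow_bounded {d} (i : 'I_d) m (G : vec d -> R) B : Prop :=
  match m with
  | O => forall z, Rabs (G z) <= B
  | S m' => exists G', partial i G G' /\ partial_pow_bounded i m' G' B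
  end.

Lemma partial_pow_bounded_le {d} (i : 'I_d) m (G : vec d -> R) B B' :
  B <= B' -> partial_pow_bounded i m G B -> partial_pow_bounded i m G B'.
Proof.
move=> le; elim: m G => [|m IH] G /=; first by move=> h z; apply: Rle_trans le.
by move=> [G' [dG h]]; exists G'; split=> //; apply: IH.
Qed.

Lemma Cm_partial_pow_bounded {d} m (G : vec d -> R) : Cm m G -> periodic_v G ->
  exists B, 0 <= B /\ forall i, partial_pow_bounded i m G B.
Proof.
move=> hG perG.
have h i : exists B, partial_pow_bounded i m G B.
  elim: m G hG perG => [|m IH] G hG perG /=; first exact: periodic_continuous_bounded.
  have [G' [dG hG']] := (proj2 hG) i.
  have [B hB] := IH G' hG' (partial_periodic i G G' dG perG).
  by exists B, G'.
pose B i := proj1_sig (constructive_indefinite_description _ (h i)).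
exists (normv B); split=> [|i]; first exact: normv_ge0.
apply: (@partial_pow_bounded_le _ _ _ _ (B i)).
  by apply: Rle_trans (Rle_abs _) _; apply: normv_ge.
exact: proj2_sig (constructive_indefinite_description _ (h i)).
Qed.

(** A difference of step [h] trades one derivative for a factor [h] by the mean value inequality,
    and it commutes with the remaining derivatives. *)
Lemma partial_pow_bounded_diff {d} (i : 'I_d) m (G : vec d -> R) B h : 0 <= h ->
  partial_pow_bounded i m.+1 G B ->
  partial_pow_bounded i m (fun z => G (vupd z i (z i + h)) - G z) (h * B).
Proof.
move=> h0; elim: m G => [|m IH] G.
  move=> [G' [dG hB]] z.
  have := derivative_bound (fun s => G (vupd z i s)) (fun s => G' (vupd z i s)) B (z i) (z i + h).
  have -> : z i + h - z i = h by ring.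
  rewrite vupd_same (Rabs_right h) ?(Rmult_comm h); last lra.
  by apply=> s //; apply: partial_line.
move=> [G' [dG hG']].
exists (fun z => G' (vupd z i (z i + h)) - G' z); split; last exact: IH.
move=> x; apply: derivable_pt_lim_minus; last exact: dG.
have -> : (fun s => G (vupd (vupd x i s) i (vupd x i s i + h))) =
          (fun s => G (vupd x i (1 * s + h))).
  by apply: functional_extensionality => s; rewrite vupd_vupd vupd_at Rmult_1_l.
apply: derivable_pt_lim_eq.
  apply: (derivable_pt_lim_affine (fun s => G (vupd x i s))); exact: partial_line.
by rewrite !Rmult_1_l.
Qed.

(** The coordinates are changed one at a time: [y q] takes its first [q] coordinates from [z'] and
    the others from [z]. *)
Lemma partials_bounded_lipschitz {d} (G : vec d -> R) B delta (z z' : vec d) :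
  (forall i, partial_pow_bounded i 1 G B) ->
  0 <= B -> (forall i, Rabs (z' i - z i) <= delta) ->
  Rabs (G z' - G z) <= INR d * (B * delta).
Proof.
move=> hG B0 hz.
pose y q : vec d := fun i => if (i < q)%N then z' i else z i.
have step q : (q <= d)%N -> Rabs (G (y q) - G z) <= INR q * (B * delta).
  elim: q => [|q IH] hq.
    have -> : y 0%N = z by [].
    by rewrite Rminus_diag Rabs_R0 /=; lra.
  pose i := Ordinal hq.
  have y0 : y q = vupd (y q) i (z i).
    have <- : y q i = z i by rewrite /y ltnn.
    by rewrite vupd_same.
  have y1 : y q.+1 = vupd (y q) i (z' i).
    apply: functional_extensionality => j; rewrite /vupd /y ltnS leq_eqVlt.
    case: (eqVneq j i) => [-> /=|ne]; first by rewrite eqxx.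
    by have -> : (nat_of_ord j == q) = false by apply/negP => /eqP e; case/eqP: ne; apply: val_inj.
  have [G' [dG hB]] := hG i.
  have h1 := derivative_bound (fun s => G (vupd (y q) i s))
    (fun s => G' (vupd (y q) i s)) B (z i) (z' i)
    (fun s => partial_line i G G' (y q) s dG) (fun s => hB _).
  rewrite -y0 -y1 in h1.
  have h2 := Rmult_le_compat_l _ _ _ B0 (hz i).
  have h3 := IH (ltnW hq).
  have -> : G (y q.+1) - G z = (G (y q.+1) - G (y q)) + (G (y q) - G z) by ring.
  apply: Rle_trans (Rabs_triang _ _) _; rewrite S_INR; lra.
have -> : z' = y d by apply: functional_extensionality => i; rewrite /y ltn_ord.
exact: step.
Qed.

(** * Trigonometric interpolation *)

Lemma cos_period_Z x q : cos (x + 2 * PI * IZR q) = cos x.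
Proof.
have nat_case y m : cos (y + 2 * PI * INR m) = cos y.
  by rewrite -(cos_period y m); congr cos; ring.
case: (Z_le_gt_dec 0 q) => hq.
  by rewrite -(Z2Nat.id q hq) -INR_IZR_INZ nat_case.
rewrite -(nat_case (x + 2 * PI * IZR q) (Z.to_nat (- q))) INR_IZR_INZ Z2Nat.id; last lia.
by rewrite opp_IZR; congr cos; ring.
Qed.

Lemma dotv_sub {d} (x y z : vec d) : dotv x (vsub y z) = dotv x y - dotv x z.
Proof.
by rewrite -Rsum_sub; apply: eq_bigr => i _; rewrite /vsub; ring.
Qed.

Lemma dotv_vscale {d} (x y : vec d) a : dotv x (vscale a y) = a * dotv x y.
Proof. by rewrite -Rsum_mull; apply: eq_bigr => i _; rewrite /vscale; ring. Qed.

Lemma dotvC {d} (x y : vec d) : dotv x y = dotv y x.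
Proof. by apply: eq_bigr => i _; ring. Qed.

Lemma dotv_vupd {d} (x z : vec d) i a :
  dotv x (vupd z i (z i + a)) = dotv x z + x i * a.
Proof.
rewrite /dotv (bigD1 i) //= [in RHS](bigD1 i) //= vupd_at.
rewrite (eq_bigr (fun j => x j * z j)); first by ring.
by move=> j /negPf ne; rewrite /vupd ne.
Qed.

Lemma dotv_int {d} (k l : 'I_d -> Z) :
  exists q, dotv (fun i => IZR (k i)) (fun i => IZR (l i)) = IZR q.
Proof.
apply: (big_ind (fun x => exists q, x = IZR q)) => [|_ _ [p ->] [q ->]|i _].
- by exists 0%Z.
- by exists (p + q)%Z; rewrite plus_IZR.
- by exists (k i * l i)%Z; rewrite mult_IZR.
Qed.

Lemma dotv_add_int {d} (x z : vec d) (l : 'I_d -> Z) :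
  dotv x (fun i => z i + IZR (l i)) = dotv x z + dotv x (fun i => IZR (l i)).
Proof. by rewrite -big_split; apply: eq_bigr => i _ /=; ring. Qed.

Lemma dotv_abs_le {d} (x y : vec d) a b : 0 <= a -> 0 <= b ->
  (forall i, Rabs (x i) <= a) -> (forall i, Rabs (y i) <= b) ->
  Rabs (dotv x y) <= INR d * (a * b).
Proof.
move=> a0 b0 ha hb; apply: Rle_trans (Rabs_Rsum _ _ _) _.
have <- : \big[Rplus/0]_(i < d) (a * b) = INR d * (a * b) by rewrite Rsum_const card_ord.
apply: Rsum_le => i _; rewrite Rabs_mult.
by apply: Rmult_le_compat => //; apply: Rabs_pos.
Qed.

(** * The grid, discrete Fourier coefficients and the interpolant *)

Section Grid.
Context {d : nat} (n : nat).
Local Notation N := (n.*2.+1).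
Local Notation index := {ffun 'I_d -> 'I_N}.
Let h := / INR N.

Definition grid (j : index) : vec d := fun i => INR (j i) * h.

(** Indices [0 .. 2 n] stand for the symmetric range of frequencies [- n .. n], with [n] standing
    for frequency zero. *)
Definition freq (k : index) : 'I_d -> Z := fun i => (Z.of_nat (k i) - Z.of_nat n)%Z.

Definition freqv (k : index) : vec d := fun i => IZR (freq k i).

Lemma INR_N_gt0 : 0 < INR N.
Proof. by apply: lt_0_INR; lia. Qed.

Lemma INR_N : INR N = 2 * INR n + 1.
Proof. by rewrite S_INR -addnn plus_INR; ring. Qed.

(** Frequencies are affine in grid points, so translation invariance of sums over the grid also
    serves sums over frequencies. *)
Lemma freqvE k i : freqv k i = INR N * grid k i - INR n.
Proof.
rewrite /freqv /freq minus_IZR -!INR_IZR_INZ /grid /h.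
by field; have := INR_N_gt0; lra.
Qed.

(** The cyclic successor in coordinate [i] permutes the indices and moves each grid point by [h], up
    to an integer. *)
Lemma sum_grid_translate (H : vec d -> R) i : periodic_v H ->
  \big[Rplus/0]_(j : index) H (vupd (grid j) i (grid j i + h)) =
  \big[Rplus/0]_(j : index) H (grid j).
Proof.
move=> per.
pose sh (j : index) : index := [ffun l => if l == i then ordS (j l) else j l].
have sh_inj : injective sh.
  move=> j j' e; apply/ffunP => l; have := congr1 (fun f : index => f l) e.
  by rewrite !ffunE; case: eqP => // _ /ordS_inj.
rewrite [RHS](reindex_inj sh_inj); apply: eq_bigr => j _.
have hN := INR_N_gt0.
(* At the last index the translated coordinate is [1], and periodicity brings it back to [0]. *)
pose k l : Z := if (l == i) && (nat_of_ord (j i) == n.*2) then (-1)%Z else 0%Z.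
rewrite -(per _ k); congr H; apply: functional_extensionality => l.
rewrite /vupd /grid ffunE /k; case: (eqVneq l i) => [->|_] /=; last ring.
case: (eqVneq (nat_of_ord (j i)) n.*2) => [e|ne].
  rewrite e modnn -[INR n.*2]/(INR N.-1).
  have -> : INR N.-1 = INR N - 1 by rewrite S_INR /=; ring.
  by rewrite /h Rmult_0_l; field; lra.
rewrite modn_small; last by rewrite ltn_neqAle eqSS ne ltn_ord.
by rewrite S_INR; ring.
Qed.

(* Rather than complex coefficients, the real part of the [k]-th one rotated by every phase [phi]. *)
Definition dft (G : vec d -> R) (k : index) (phi : R) : R :=
  / INR #|{: index}| *
  \big[Rplus/0]_(j : index) (G (grid j) * cos (2 * PI * dotv (freqv k) (grid j) - phi)).

Lemma card_index_gt0 : 0 < INR #|{: index}|.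
Proof.
apply: lt_0_INR; apply/ltP; apply/card_gt0P.
by exists [ffun=> ord0].
Qed.

Lemma dft_bound G k phi B : (forall z, Rabs (G z) <= B) -> Rabs (dft G k phi) <= B.
Proof.
move=> hB; have V0 := card_index_gt0.
rewrite Rabs_mult Rabs_inv (Rabs_right (INR _)); last lra.
apply: (Rmult_le_reg_l _ _ _ V0); rewrite -Rmult_assoc Rmult_inv_r ?Rmult_1_l; last lra.
apply: Rle_trans (Rabs_Rsum _ _ _) _; rewrite -Rsum_const.
apply: Rsum_le => j _; rewrite Rabs_mult.
have := hB (grid j); have := Rabs_pos (G (grid j)).
have : Rabs (cos (2 * PI * dotv (freqv k) (grid j) - phi)) <= 1.
  by apply: Rabs_le; apply: COS_bound.
have := Rabs_pos (cos (2 * PI * dotv (freqv k) (grid j) - phi)); nra.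
Qed.

Lemma dft_period G k phi q : dft G k (phi + 2 * PI * IZR q) = dft G k phi.
Proof.
congr (_ * _); apply: eq_bigr => j _; congr (_ * _).
by rewrite -[LHS](cos_period_Z _ q); congr cos; ring.
Qed.

(** The formula for a difference of cosines; the sine it produces is a cosine a quarter turn
    later. *)
Lemma dft_phase_sub G k phi psi :
  dft G k phi - dft G k psi =
  2 * sin ((phi - psi) / 2) * dft G k ((phi + psi) / 2 + PI / 2).
Proof.
rewrite /dft -Rmult_minus_distr_l -Rsum_sub.
rewrite (eq_bigr (fun j => 2 * sin ((phi - psi) / 2) * (G (grid j) *
   cos (2 * PI * dotv (freqv k) (grid j) - ((phi + psi) / 2 + PI / 2))))).
  by rewrite Rsum_mull -Rmult_assoc (Rmult_comm (/ _)) Rmult_assoc.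
move=> j _.
set x := 2 * PI * _.
have -> : cos (x - ((phi + psi) / 2 + PI / 2)) = sin (x - (phi + psi) / 2).
  by rewrite -cos_shift -cos_neg; congr cos; field.
rewrite -Rmult_minus_distr_l form2.
have -> : (x - phi - (x - psi)) / 2 = - ((phi - psi) / 2) by field.
have -> : (x - phi + (x - psi)) / 2 = x - (phi + psi) / 2 by field.
by rewrite sin_neg; ring.
Qed.

(** Summation by parts: translating the grid moves the difference from [G] to the character, where
    it is a rotation of the phase by [b]. *)
Lemma dft_diff G k i phi : periodic_v G ->
  dft (fun z => G (vupd z i (z i + h)) - G z) k phi =
  2 * sin (PI * freqv k i * h) * dft G k (phi + PI * freqv k i * h + PI / 2).
Proof.
move=> per.
pose b := 2 * PI * freqv k i * h.
have -> : dft (fun z => G (vupd z i (z i + h)) - G z) k phi =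
          dft G k (phi + b) - dft G k phi.
  rewrite /dft -Rmult_minus_distr_l -Rsum_sub; congr (_ * _).
  rewrite (eq_bigr _ (fun j _ => Rmult_minus_distr_r _ _ _)) !Rsum_sub; congr (_ - _).
  pose H z := G z * cos (2 * PI * dotv (freqv k) z - (phi + b)).
  rewrite -[RHS](sum_grid_translate H i); last first.
    move=> z l; rewrite /H per dotv_add_int; congr (_ * _).
    have [q ->] := dotv_int (freq k) l.
    by rewrite -[RHS](cos_period_Z _ q); congr cos; ring.
  apply: eq_bigr => j _; rewrite /H dotv_vupd; congr (_ * cos _).
  by rewrite /b; ring.
rewrite dft_phase_sub /b; congr (2 * sin _ * dft _ _ _); field.
Qed.

Lemma dft_decay m i G B k phi : periodic_v G -> partial_pow_bounded i m G B ->
  (2 * Rabs (sin (PI * freqv k i * h))) ^ m * Rabs (dft G k phi) <= h ^ m * B.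
Proof.
have h0 : 0 <= h by apply/Rlt_le/Rinv_0_lt_compat/INR_N_gt0.
elim: m G B phi => [|m IH] G B phi per hB.
  by rewrite /= !Rmult_1_l; apply: dft_bound.
set s := sin _.
(* The phase is chosen so that the rotation in [dft_diff] brings it back to [phi]. *)
have := IH _ _ (phi - PI * freqv k i * h - PI / 2) _
  (partial_pow_bounded_diff i m G B h h0 hB).
rewrite dft_diff // -/s.
have -> : phi - PI * freqv k i * h - PI / 2 + PI * freqv k i * h + PI / 2 = phi by ring.
rewrite !Rabs_mult (Rabs_right 2); last lra.
move=> /= hi.
have -> : h * h ^ m * B = h ^ m * (h * B) by ring.
apply: Rle_trans (hi _); first by apply: Req_le; ring.
move=> z l; rewrite per; congr (_ - _).
rewrite -[RHS](per _ l); congr G; apply: functional_extensionality => j.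
by rewrite /vupd; case: eqP => [->|_] //; ring.
Qed.

(* Translating [k] by a unit vector rotates the phase, which is possible only if the sum vanishes at every phase. *)
Lemma sum_character_eq0 (a : 'I_d -> Z) i phi :
  a i <> 0%Z -> (Z.abs (a i) < Z.of_nat N)%Z ->
  \big[Rplus/0]_(k : index) cos (2 * PI * dotv (freqv k) (fun l => IZR (a l) * h) + phi) = 0.
Proof.
move=> a0 aN; have hN := INR_N_gt0.
pose w : vec d := fun l => IZR (a l) * h.
pose x k := 2 * PI * dotv (freqv k) w.
have shift psi : \big[Rplus/0]_(k : index) cos (x k + (psi + 2 * PI * w i)) =
                 \big[Rplus/0]_(k : index) cos (x k + psi).
  pose H (z : vec d) := cos (2 * PI * dotv w (fun l => INR N * z l - INR n) + psi).
  have e k : cos (x k + psi) = H (grid k).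
    rewrite /x /H dotvC; congr (cos (2 * PI * dotv _ _ + _)).
    by apply: functional_extensionality => l; rewrite freqvE.
  rewrite (eq_bigr _ (fun k _ => e k)) -(sum_grid_translate H i).
    apply: eq_bigr => k _; rewrite /H /x dotvC.
    have -> : (fun l => INR N * vupd (grid k) i (grid k i + h) l - INR n) =
              vupd (freqv k) i (freqv k i + 1).
      apply: functional_extensionality => l; rewrite /vupd !freqvE.
      by case: eqP => // _; rewrite /h; field; lra.
    by rewrite dotv_vupd; congr cos; ring.
  move=> z l; rewrite /H.
  have -> : (fun j => INR N * (z j + IZR (l j)) - INR n) =
            (fun j => (INR N * z j - INR n) + IZR (Z.of_nat N * l j)).
    apply: functional_extensionality => j.
    by rewrite mult_IZR -INR_IZR_INZ; ring.
  rewrite dotv_add_int.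
  have -> : dotv w (fun j => IZR (Z.of_nat N * l j)) =
            dotv (fun j => IZR (a j)) (fun j => IZR (l j)).
    apply: eq_bigr => j _; rewrite mult_IZR -INR_IZR_INZ /w /h; field; lra.
  have [q ->] := dotv_int a l.
  by rewrite -[RHS](cos_period_Z _ q); congr cos; ring.
(* [w i = a i / N] lies strictly between [-1] and [1] and is not zero. *)
have sn : sin (PI * w i) <> 0.
  have pi := PI_RGT_0.
  have bound c : (0 < c)%Z -> (c < Z.of_nat N)%Z -> 0 < sin (PI * (IZR c * h)).
    move=> /IZR_lt c0 /IZR_lt; rewrite -INR_IZR_INZ => cN.
    have h1 : 0 < IZR c * h by apply: Rmult_lt_0_compat => //; apply: Rinv_0_lt_compat.
    have h2 : IZR c * h < 1.
      by apply: (Rmult_lt_reg_r (INR N)) => //; rewrite /h Rmult_assoc Rinv_l; lra.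
    by apply: sin_gt_0; nra.
  case: (Z_lt_le_dec 0 (a i)) => hi.
    by have := bound (a i) hi; rewrite /w => hb; have := hb ltac:(lia); lra.
  have := bound (- a i)%Z ltac:(lia) ltac:(lia).
  have -> : PI * (IZR (- a i) * h) = - (PI * w i) by rewrite opp_IZR /w; ring.
  by rewrite sin_neg; lra.
(* With this phase the difference of the two equal sums is [2 * sin (PI * w i)] times the sum at
   phase [phi]. *)
have := shift (phi - PI / 2 - PI * w i) => e.
have : \big[Rplus/0]_(k : index) (cos (x k + (phi - PI / 2 - PI * w i + 2 * PI * w i)) -
     cos (x k + (phi - PI / 2 - PI * w i))) = 0 by rewrite Rsum_sub e Rminus_diag.
rewrite (eq_bigr (fun k => 2 * sin (PI * w i) * cos (x k + phi))); last first.
  move=> k _; rewrite form2.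
  have -> : (x k + (phi - PI / 2 - PI * w i + 2 * PI * w i) -
             (x k + (phi - PI / 2 - PI * w i))) / 2 = PI * w i by field.
  have -> : (x k + (phi - PI / 2 - PI * w i + 2 * PI * w i) +
             (x k + (phi - PI / 2 - PI * w i))) / 2 = - (PI / 2 - (x k + phi)) by field.
  by rewrite sin_neg sin_shift; ring.
rewrite Rsum_mull => /Rmult_integral [] //; lra.
Qed.

(** At the phase [2 * PI * dotv (freqv k) z] the coefficient is the real part of the [k]-th term of
    the trigonometric polynomial at [z]. *)
Definition interp (G : vec d -> R) (z : vec d) : R :=
  \big[Rplus/0]_(k : index) dft G k (2 * PI * dotv (freqv k) z).

(** Exchanging the sums produces a discrete Dirichlet kernel [c], which by orthogonality of
    characters vanishes at every grid point other than [j]. *)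
Lemma interp_grid G j : interp G (grid j) = G (grid j).
Proof.
have V0 := card_index_gt0.
pose c j' := \big[Rplus/0]_(k : index)
  cos (2 * PI * dotv (freqv k) (grid j') - 2 * PI * dotv (freqv k) (grid j)).
have -> : interp G (grid j) =
          / INR #|{: index}| * \big[Rplus/0]_(j' : index) (G (grid j') * c j').
  rewrite /interp Rsum_mull; congr (_ * _); rewrite exchange_big /=.
  by apply: eq_bigr => j' _; rewrite Rsum_mull.
rewrite (bigD1 j) //= big1 ?Rplus_0_r => [|j' ne].
  have -> : c j = INR #|{: index}|.
    rewrite /c (eq_bigr (fun=> 1)) => [|k _]; last by rewrite Rminus_diag cos_0.
    by rewrite Rsum_const Rmult_1_r.
  by field; lra.
have [i hi] : exists i, j' i != j i.
  apply/existsP; apply: contraNT ne; rewrite negb_exists => /forallP e.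
  by apply/eqP/ffunP => i; apply/eqP; have := e i; rewrite negbK.
pose a l : Z := (Z.of_nat (j' l) - Z.of_nat (j l))%Z.
have := sum_character_eq0 a i 0.
have hne : nat_of_ord (j' i) <> j i by move=> e; case/eqP: hi; apply: val_inj.
have l1 := ltP (ltn_ord (j' i)); have l2 := ltP (ltn_ord (j i)).
move=> /(_ ltac:(rewrite /a; lia) ltac:(rewrite /a; lia)) e.
suff -> : c j' = 0 by ring.
rewrite -[RHS]e; apply: eq_bigr => k _.
rewrite Rplus_0_r -Rmult_minus_distr_l -dotv_sub; congr (cos (2 * PI * dotv _ _)).
apply: functional_extensionality => l.
by rewrite /vsub /grid /a minus_IZR -!INR_IZR_INZ; ring.
Qed.

Lemma interp_periodic G : periodic_v (interp G).
Proof.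
move=> z l; apply: eq_bigr => k _; rewrite dotv_add_int.
have [q ->] := dotv_int (freq k) l.
by rewrite Rmult_plus_distr_l dft_period.
Qed.

Lemma near_grid (z : vec d) : (forall i, 0 <= z i < 1) ->
  exists j, forall i, Rabs (z i - grid j i) <= h.
Proof.
move=> hz; have hN := INR_N_gt0.
have ex i : exists m : 'I_N, Rabs (z i - INR m * h) <= h.
  have z0 : 0 <= INR N * z i by apply: Rmult_le_pos; have := hz i; lra.
  pose q := Int_part (INR N * z i); have [q1 q2] := base_Int_part (INR N * z i).
  have q0 : (0 <= q)%Z.
    have : (-1 < q)%Z by apply: lt_IZR; rewrite /q; lra.
    lia.
  have qN : (Z.to_nat q < N)%N.
    apply/ltP; apply: INR_lt; rewrite INR_IZR_INZ Z2Nat.id //.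
    apply: (Rle_lt_trans _ (INR N * z i)) => //.
    by have := hz i; nra.
  exists (Ordinal qN) => /=.
  rewrite INR_IZR_INZ Z2Nat.id //.
  apply: (Rmult_le_reg_l (INR N)) => //.
  rewrite -{1}(Rabs_right (INR N)) -?Rabs_mult; last lra.
  have -> : INR N * (z i - IZR q * h) = INR N * z i - IZR q by rewrite /h; field; lra.
  have -> : INR N * h = 1 by rewrite /h; field; lra.
  by apply: Rabs_le; rewrite /q; lra.
exists [ffun i => proj1_sig (constructive_indefinite_description _ (ex i))] => i.
rewrite /grid ffunE.
exact: proj2_sig (constructive_indefinite_description _ (ex i)).
Qed.

Lemma freqv_abs_le k i : Rabs (freqv k i) <= INR n.
Proof.
have kN := ltP (ltn_ord (k i)); have n2 := addnn n; rewrite -plusE in n2.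
by rewrite /freqv /freq INR_IZR_INZ; apply: Rabs_le; rewrite -opp_IZR; split; apply: IZR_le; lia.
Qed.

End Grid.

(** * Inequalities for sines and powers, and one-dimensional weights *)

Lemma sin_ge_third x : 0 <= x <= PI / 2 -> x / 3 <= sin x.
Proof.
move=> [x0 x1]; have pi4 := PI_4.
have [lb _] := sin_bound x 0 x0 ltac:(lra).
apply: Rle_trans lb.
rewrite /sin_approx /sin_term /=.
(* The Taylor lower bound is [x - x ^ 3 / 6], and [1 - 4 / 6 = 1 / 3]. *)
have xx : x * x <= 4 by nra.
have := Rmult_le_compat_l _ _ _ x0 xx; lra.
Qed.

Lemma Rabs_sin_ge x : Rabs x <= PI / 2 -> Rabs x / 3 <= Rabs (sin x).
Proof.
move=> hx; have hp := Rabs_pos x.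
apply: Rle_trans (sin_ge_third (Rabs x) (conj hp hx)) _.
case: (Rle_lt_dec 0 x) => h; first by rewrite (Rabs_right x); [exact: Rle_abs|lra].
by rewrite (Rabs_left x) // sin_neg -Rabs_Ropp; exact: Rle_abs.
Qed.

(** The maximum starts from the default [0]; positivity makes it one of the values. *)
Lemma bigRmax_attained (I : finType) (F : I -> R) :
  0 < \big[Rmax/0]_(i : I) F i -> exists i, F i = \big[Rmax/0]_(i : I) F i.
Proof.
move=> h.
have : \big[Rmax/0]_(i : I) F i = 0 \/ exists i, F i = \big[Rmax/0]_(i : I) F i; last first.
  by case=> // e; lra.
apply: (big_ind (fun x => x = 0 \/ exists i, F i = x)) => [|x y hx hy|i _].
- by left.
- by rewrite /Rmax; case: Rle_dec.
- by right; exists i.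
Qed.

Lemma Rprod_le (I : finType) (F G : I -> R) : (forall i, 0 <= F i <= G i) ->
  0 <= \big[Rmult/1]_(i : I) F i <= \big[Rmult/1]_(i : I) G i.
Proof.
move=> h; apply: (big_ind2 (fun x y => 0 <= x <= y)) => //; first lra.
move=> x1 x2 y1 y2 h1 h2; split; first by apply: Rmult_le_pos; lra.
by apply: Rmult_le_compat; lra.
Qed.

Lemma Rprod_const d c : \big[Rmult/1]_(i < d) c = c ^ d.
Proof.
rewrite big_const card_ord; elim: d => [|d IH] //.
by rewrite iterS IH.
Qed.

Lemma Rpower_base1 x : Rpower 1 x = 1.
Proof. by rewrite /Rpower ln_1 Rmult_0_r exp_0. Qed.

Lemma Rpower_gt0 x y : 0 < Rpower x y.
Proof. exact: exp_pos. Qed.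

Lemma ln_ge x : 0 < x -> 1 - / x <= ln x.
Proof.
move=> x0; have ix := Rinv_0_lt_compat _ x0.
have := exp_ineq1_le (ln (/ x)); rewrite exp_ln // ln_Rinv //; lra.
Qed.

(** Comparison with an integral, done by hand: with [y = x + 1], [(y / x) ^ (p - 1)] is at least
    [1 + (p - 1) * ln (y / x)], and [ln (y / x)] is at least [1 - x / y = 1 / y]. *)
Lemma Rpower_telescope p x : 1 < p -> 0 < x ->
  (p - 1) * Rpower (x + 1) (- p) <= Rpower x (1 - p) - Rpower (x + 1) (1 - p).
Proof.
move=> p1 x0; set y := x + 1; have y0 : 0 < y by rewrite /y; lra.
have ix := Rinv_0_lt_compat _ x0; have iy := Rinv_0_lt_compat _ y0.
have yx : 0 < y / x by apply: Rdiv_lt_0_compat.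
have -> : Rpower x (1 - p) = Rpower y (1 - p) * Rpower (y / x) (p - 1).
  rewrite /Rdiv -Rpower_mult_distr // /Rpower ln_Rinv //.
  by rewrite -!exp_plus; congr exp; ring.
have -> : Rpower y (- p) = Rpower y (1 - p) * / y.
  rewrite -{3}(Rpower_1 y y0) -Rpower_Ropp -Rpower_plus; congr Rpower; ring.
have h1 : 1 + (p - 1) * / y <= Rpower (y / x) (p - 1).
  have h2 := ln_ge _ yx.
  have h3 : 1 - / (y / x) = / y by rewrite /y; field; lra.
  rewrite h3 in h2; apply: Rle_trans (exp_ineq1_le _).
  by apply: Rplus_le_compat_l; apply: Rmult_le_compat_l => //; lra.
have := Rmult_le_compat_l _ _ _ (Rlt_le _ _ (Rpower_gt0 y (1 - p))) h1; lra.
Qed.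

(* The product of these weights over the coordinates dominates a power of the max norm, and its sum over a box factors into one-dimensional sums. *)
Definition weight p x := Rpower (Rmax 1 (Rabs x)) (- p).

Lemma weight_ge1 p x : 1 <= Rabs x -> weight p x = Rpower (Rabs x) (- p).
Proof. by move=> h; rewrite /weight Rmax_right. Qed.

Lemma sum_weight_le p n : 1 < p ->
  \big[Rplus/0]_(k < n.*2.+1) weight p (IZR (Z.of_nat k - Z.of_nat n)) <= 3 + 2 / (p - 1).
Proof.
move=> p1.
pose s n := \big[Rplus/0]_(k < n.*2.+1) weight p (IZR (Z.of_nat k - Z.of_nat n)).
have s0 : s 0%N = 1.
  by rewrite /s big_ord_recl big_ord0 /weight /= Rabs_R0 Rmax_left ?Rpower_base1; lra.
have sS m : s m.+1 = s m + 2 * Rpower (INR m + 1) (- p).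
  have w z : Z.abs z = Z.of_nat m.+1 -> weight p (IZR z) = Rpower (INR m + 1) (- p).
    move=> e; have ez : Rabs (IZR z) = INR m + 1.
      by rewrite -abs_IZR e -INR_IZR_INZ S_INR.
    by rewrite weight_ge1 ez //; have := pos_INR m; lra.
  have m2 := addnn m; rewrite -plusE in m2.
  rewrite /s doubleS big_ord_recl big_ord_recr.
  rewrite w; last by rewrite /=; lia.
  rewrite [X in _ + (_ + X)]w; last first.
    have -> : nat_of_ord (lift ord0 (@ord_max m.*2.+1)) = m.*2.+2 by [].
    lia.
  rewrite (eq_bigr (fun k : 'I_m.*2.+1 => weight p (IZR (Z.of_nat k - Z.of_nat m)))).
    by rewrite /=; ring.
  move=> k _; have e : nat_of_ord (lift ord0 (widen_ord (leqnSn m.*2.+1) k)) = k.+1 by [].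
  by congr (weight _ (IZR _)); rewrite e; lia.
(* The frequencies [-1, 0, 1] give [3]. Subtracting the remaining tail strengthens the claim enough
   for induction by telescoping. *)
have s1 m : s m.+1 <= 3 + 2 / (p - 1) - 2 / (p - 1) * Rpower (INR m.+1) (1 - p).
  elim: m => [|m IH].
    by rewrite sS s0 /= Rplus_0_l !Rpower_base1; lra.
  rewrite sS; have pos := pos_INR m.
  have := Rpower_telescope p (INR m.+1) p1 (ltac:(rewrite S_INR; lra)).
  rewrite -[INR m.+2]/(INR m.+1 + 1).
  have ip : 0 < 2 / (p - 1) by apply: Rdiv_lt_0_compat; lra.
  move=> /(Rmult_le_compat_l _ _ _ (Rlt_le _ _ ip)).
  have -> : 2 / (p - 1) * ((p - 1) * Rpower (INR m.+1 + 1) (- p)) =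
            2 * Rpower (INR m.+1 + 1) (- p) by field; lra.
  lra.
have ip : 0 < 2 / (p - 1) by apply: Rdiv_lt_0_compat; lra.
rewrite -/(s n); case: n => [|n]; first by rewrite s0; lra.
apply: Rle_trans (s1 n) _.
have := Rmult_lt_0_compat _ _ ip (Rpower_gt0 (INR n.+1) (1 - p)); lra.
Qed.

(** * Sums over the spectrum, decay of coefficients and small divisors *)

Section Spectrum.
Context {d : nat} (n : nat).
Local Notation N := (n.*2.+1).
Local Notation index := {ffun 'I_d -> 'I_N}.

Definition nonzero (k : index) := [exists i, nat_of_ord (k i) != n].

Lemma nonzeroP (k : index) : nonzero k -> exists i, freq n k i <> 0%Z.
Proof. by case/existsP => i /eqP ne; exists i; rewrite /freq; lia. Qed.

Lemma zero_freqv (k : index) : ~~ nonzero k -> freqv n k = fun=> 0.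
Proof.
rewrite negb_exists => /forallP h; apply: functional_extensionality => i.
by have := h i; rewrite negbK /freqv /freq => /eqP ->; rewrite Z.sub_diag.
Qed.

Lemma normv_freqv_ge1 (k : index) : nonzero k -> 1 <= normv (freqv n k).
Proof.
case/nonzeroP => i hi; apply: Rle_trans (normv_ge _ i).
by rewrite /freqv -abs_IZR; apply: IZR_le; lia.
Qed.

Lemma Rpower_normv_le_weights (k : index) p r : 0 <= p -> p * INR d <= r ->
  nonzero k -> Rpower (normv (freqv n k)) (- r) <=
    \big[Rmult/1]_(i < d) weight p (freqv n k i).
Proof.
move=> p0 pr /normv_freqv_ge1 k1; set x := normv _ in k1 *.
apply: (Rle_trans _ (Rpower x (- p * INR d))); first by apply: Rle_Rpower; lra.
rewrite -Rpower_mult Rpower_pow; last exact: Rpower_gt0.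
rewrite -Rprod_const; apply: (proj2 (Rprod_le _ _ _ _)) => i.
split; first exact/Rlt_le/Rpower_gt0.
rewrite /weight !Rpower_Ropp; apply: Rinv_le_contravar; first exact: Rpower_gt0.
apply: Rle_Rpower_l => //; split.
  by apply: Rlt_le_trans (Rmax_l _ _); lra.
by apply: Rmax_lub => //; apply: normv_ge.
Qed.

(** Extended to all frequencies, the sum of products is a product of sums. The bound is free of [n],
    which makes all later estimates uniform in the grid. *)
Lemma sum_nonzero_le (X : index -> R) (p r c : R) : 1 < p -> p * INR d <= r -> 0 <= c ->
  (forall k, nonzero k -> X k <= c * Rpower (normv (freqv n k)) (- r)) ->
  \big[Rplus/0]_(k | nonzero k) X k <= c * (3 + 2 / (p - 1)) ^ d.
Proof.
move=> p1 pr c0 hX.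
have wpos q x : 0 <= weight q x by exact/Rlt_le/Rpower_gt0.
have prod_pos (k : index) : 0 <= \big[Rmult/1]_(i < d) weight p (freqv n k i).
  by have [] := Rprod_le _ (fun i => weight p (freqv n k i)) _ (fun i => conj (wpos _ _) (Rle_refl _)).
apply: (Rle_trans _ (\big[Rplus/0]_(k | nonzero k)
    (c * \big[Rmult/1]_(i < d) weight p (freqv n k i)))).
  apply: Rsum_le => k hk; apply: Rle_trans (hX k hk) _.
  by apply: Rmult_le_compat_l => //; apply: Rpower_normv_le_weights => //; lra.
rewrite Rsum_mull; apply: Rmult_le_compat_l => //.
apply: (Rle_trans _ (\big[Rplus/0]_(k : index) \big[Rmult/1]_(i < d) weight p (freqv n k i))).
  rewrite [X in _ <= X](bigID nonzero) /=.
  rewrite -[X in X <= _]Rplus_0_r; apply: Rplus_le_compat_l.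
  by apply: Rsum_ge0 => k _; apply: prod_pos.
rewrite -(bigA_distr_bigA (fun (i : 'I_d) (j : 'I_N) =>
   weight p (IZR (Z.of_nat j - Z.of_nat n)))).
rewrite -Rprod_const; apply: (proj2 (Rprod_le _ _ _ _)) => i; split.
  by apply: Rsum_ge0 => j _; apply: wpos.
exact: sum_weight_le.
Qed.

Context (G : vec d -> R) (m : nat) (B : R).
Hypothesis G_per : periodic_v G.
Hypothesis G_partials : forall i, partial_pow_bounded i m G B.

(** The decay estimate is used in the coordinate with the largest frequency [x]. From [x <= n] and
    [N = 2 n + 1] follows [x * h <= 1 / 2], so the sine is evaluated within a quarter turn, where
    [Rabs (sin t)] is at least [Rabs t / 3]; as [2 * PI / 3 >= 1], twice the sine dominates
    [x * h]. *)
Lemma dft_le_normv_pow (k : index) phi : nonzero k ->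
  Rabs (dft n G k phi) <= B * Rpower (normv (freqv n k)) (- INR m).
Proof.
move=> /normv_freqv_ge1 k1.
have [|i hi] := bigRmax_attained _ (fun i => Rabs (freqv n k i)).
  by rewrite -/(normv (freqv n k)); lra.
rewrite -/(normv (freqv n k)) in hi.
set x := normv _ in k1 hi *.
have hN := INR_N_gt0 n; have h0 := Rinv_0_lt_compat _ hN; set h := / _ in h0.
have := dft_decay n m i G B k phi G_per (G_partials i).
rewrite -/h => hdec.
have pi1 := PI2_1.
have e : Rabs (PI * freqv n k i * h) = PI * x * h.
  by rewrite (Rabs_mult (PI * _)) (Rabs_mult PI) hi (Rabs_right PI) ?(Rabs_right h); lra.
have xh : x * h <= / 2.
  have := freqv_abs_le n k i; rewrite hi => xn.
  apply: (Rmult_le_reg_r (INR N)) => //.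
  rewrite Rmult_assoc /h Rinv_l; last lra.
  by rewrite INR_N; lra.
have hs : x * h <= 2 * Rabs (sin (PI * freqv n k i * h)).
  have xh0 : 0 <= x * h by apply: Rmult_le_pos; lra.
  have := Rabs_sin_ge (PI * freqv n k i * h); rewrite e => hs.
  have := hs ltac:(nra); nra.
rewrite Rpower_Ropp Rpower_pow; last lra.
have xm : 0 < x ^ m by apply: pow_lt; lra.
have hm : 0 < h ^ m by apply: pow_lt.
apply: (Rmult_le_reg_l (x ^ m)) => //.
have -> : x ^ m * (B * / x ^ m) = B by field; lra.
apply: (Rmult_le_reg_l (h ^ m)) => //; apply: Rle_trans hdec.
rewrite -Rmult_assoc; apply: Rmult_le_compat_r; first exact: Rabs_pos.
rewrite -Rpow_mult_distr; apply: pow_incr; rewrite Rmult_comm; split=> //.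
by apply: Rmult_le_pos; lra.
Qed.

Context (sigma p : R).
Hypothesis B_ge0 : 0 <= B.
Hypothesis p_gt1 : 1 < p.
Hypothesis p_le : p * INR d <= INR m - sigma.
Hypothesis sigma_gt0 : 0 < sigma.

Let W := (3 + 2 / (p - 1)) ^ d.

(** Interpolation between the bounds [1] and [Rabs x] of the sine. *)
Lemma Rabs_sin_le_Rpower x y s : 0 < s <= 1 -> Rabs x <= y -> 0 < y ->
  Rabs (sin x) <= Rpower y s.
Proof.
move=> [s0 s1] xy y0.
have sin1 : Rabs (sin x) <= 1 by apply: Rabs_le; apply: SIN_bound.
case: (Rle_lt_dec 1 y) => hy.
  by apply: Rle_trans sin1 _; rewrite -{1}(Rpower_O y y0); apply: Rle_Rpower; lra.
have sx : Rabs (sin x) <= Rabs x.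
  have := derivative_bound sin cos 1 0 x derivable_pt_lim_sin.
  by rewrite sin_0 !Rminus_0_r Rmult_1_l; apply=> t; apply/Rabs_le/COS_bound.
apply: Rle_trans sx _; apply: Rle_trans xy _.
have ly : ln y < 0 by rewrite -ln_1; apply: ln_increasing.
rewrite -{1}(exp_ln y y0) /Rpower.
have : ln y <= s * ln y by nra.
by case=> [/exp_increasing|<-]; lra.
Qed.

(** Each coefficient changes by at most a multiple of [(x * delta) ^ s * x ^ (- m)], where [x] is
    the size of its frequency. Since [s <= sigma], this loses no more powers of [x] than a small
    divisor does, and the same sum converges. *)
Lemma interp_holder s delta (z z' : vec d) : 0 < s <= 1 -> s <= sigma -> 0 < delta ->
  (forall i, Rabs (z i - z' i) <= delta) ->
  Rabs (interp n G z - interp n G z') <=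
    2 * B * Rpower (PI * (INR d + 1) * delta) s * W.
Proof.
move=> s01 ss d0 hz; have pi1 := PI2_1; have dpos := pos_INR d.
rewrite /interp -Rsum_sub; apply: Rle_trans (Rabs_Rsum _ _ _) _.
rewrite (bigID nonzero) /= [X in _ + X]big1 ?Rplus_0_r => [|k /zero_freqv k0]; last first.
  rewrite k0.
  have e y : dotv (fun _ : 'I_d => 0) y = 0 by apply: big1 => i _; ring.
  by rewrite !e Rminus_diag Rabs_R0.
apply: sum_nonzero_le p_gt1 p_le _ _.
  by apply: Rmult_le_pos; [lra|exact/Rlt_le/Rpower_gt0].
move=> k hk; have k1 := normv_freqv_ge1 k hk.
rewrite dft_phase_sub (Rabs_mult (2 * _)) (Rabs_mult 2) (Rabs_right 2); last lra.
have := dft_le_normv_pow k ((2 * PI * dotv (freqv n k) z +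
   2 * PI * dotv (freqv n k) z') / 2 + PI / 2) hk.
set x := normv _ in k1 *.
have -> : (2 * PI * dotv (freqv n k) z - 2 * PI * dotv (freqv n k) z') / 2 =
          PI * dotv (freqv n k) (vsub z z') by rewrite dotv_sub; field.
(* [INR d + 1] in place of [INR d] keeps the base of the power positive when [d = 0]. *)
have dx : Rabs (PI * dotv (freqv n k) (vsub z z')) <= PI * (INR d + 1) * delta * x.
  rewrite Rabs_mult (Rabs_right PI); last lra.
  have := dotv_abs_le (freqv n k) (vsub z z') x delta ltac:(lra) ltac:(lra)
            (normv_ge _) hz.
  have := Rmult_lt_0_compat x delta ltac:(lra) d0 => xd h.
  have -> : PI * (INR d + 1) * delta * x = PI * ((INR d + 1) * (x * delta)) by ring.
  by apply: Rmult_le_compat_l; lra.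
have y0 : 0 < PI * (INR d + 1) * delta.
  by apply: Rmult_lt_0_compat => //; apply: Rmult_lt_0_compat; lra.
have x0 : 0 < x by lra.
have := Rabs_sin_le_Rpower _ _ s s01 dx (Rmult_lt_0_compat _ _ y0 x0).
rewrite -Rpower_mult_distr //.
set S := Rpower (_ * delta) s; set D := Rabs (dft _ _ _ _) => hS hD.
have hp : Rpower x s * Rpower x (- INR m) <= Rpower x (- (INR m - sigma)).
  by rewrite -Rpower_plus; apply: Rle_Rpower; lra.
have S0 : 0 < S by apply: Rpower_gt0.
have := Rmult_le_compat _ _ _ _ (Rabs_pos _) (Rabs_pos _) hS hD.
have BS : 0 <= B * S by apply: Rmult_le_pos; lra.
have := Rmult_le_compat_l _ _ _ BS hp; rewrite -/D; lra.
Qed.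

(** The interpolant is exact at a nearby grid point; from there to [z] its change is bounded by the
    Hölder estimate and that of [G] by its first derivatives. *)
Lemma interp_error s B1 z : 0 < s <= 1 -> s <= sigma -> 0 <= B1 ->
  (forall i, partial_pow_bounded i 1 G B1) ->
  Rabs (interp n G z - G z) <=
    2 * B * Rpower (PI * (INR d + 1) * / INR N) s * W + INR d * (B1 * / INR N).
Proof.
move=> s01 ss B10 hB1.
have [z' [l [hz ->]]] := periodic_unit_cube z.
rewrite interp_periodic G_per.
have [j hj] := near_grid n z' hz.
have -> : interp n G z' - G z' = (interp n G z' - interp n G (grid n j)) +
     (G (grid n j) - G z') by rewrite interp_grid; ring.
apply: Rle_trans (Rabs_triang _ _) _; apply: Rplus_le_compat.
  by apply: interp_holder => //; apply: Rinv_0_lt_compat; apply: INR_N_gt0.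
apply: partials_bounded_lipschitz => // i; rewrite Rabs_minus_sym; exact: hj.
Qed.

Context (xi0 : vec d) (Cxi : R).
Hypothesis Cxi_gt0 : 0 < Cxi.
Hypothesis xi0_dioph : forall k : 'I_d -> Z, (exists i, k i <> 0%Z) ->
  Rabs (dotv xi0 (fun i => IZR (k i))) >=
    Cxi * Rpower (normv (fun i => IZR (k i) : R)) (- sigma).

Let c k := dotv xi0 (freqv n k).

Lemma small_divisor (k : index) : nonzero k ->
  Cxi * Rpower (normv (freqv n k)) (- sigma) <= Rabs (c k).
Proof. by move=> /nonzeroP /xi0_dioph /Rge_le. Qed.

Lemma small_divisor_neq0 (k : index) : nonzero k -> c k <> 0.
Proof.
move=> /small_divisor h e; rewrite e Rabs_R0 in h.
have := Rmult_lt_0_compat _ _ Cxi_gt0 (Rpower_gt0 (normv (freqv n k)) (- sigma)); lra.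
Qed.

Lemma derivable_dft k phi :
  derivable_pt_lim (dft n G k) phi (dft n G k (phi + PI / 2)).
Proof.
apply: derivable_pt_lim_scal.
apply: (derivable_pt_lim_Rsum _ (fun j phi =>
  G (grid n j) * cos (2 * PI * dotv (freqv n k) (grid n j) - phi))) => j.
apply: derivable_pt_lim_scal.
have -> : (fun s => cos (2 * PI * dotv (freqv n k) (grid n j) - s)) =
          (fun s => cos (-1 * s + 2 * PI * dotv (freqv n k) (grid n j))).
  by apply: functional_extensionality => s; congr cos; ring.
apply: derivable_pt_lim_eq.
  by apply: derivable_pt_lim_affine; apply: derivable_pt_lim_cos.
set x := 2 * PI * _.
have -> : x - (phi + PI / 2) = - (PI / 2 - (-1 * phi + x)) by field.
by rewrite cos_neg cos_shift; ring.
Qed.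

(** On the line each mode oscillates with frequency [c k], and integration divides it by
    [2 * PI * c k], at a cost of order [|k| ^ sigma]. The zero frequency integrates to the linear
    part and gives the slope [a]. *)
Lemma interp_line_antiderivative : exists a Q,
  (forall r, derivable_pt_lim Q r (interp n G (vscale r xi0))) /\
  (forall r, Rabs (Q r - a * r) <= B / Cxi * W).
Proof.
have pi1 := PI2_1.
pose q k r := if nonzero k then
  - / (2 * PI * c k) * dft n G k (2 * PI * c k * r + PI / 2) else dft n G k 0 * r.
exists (\big[Rplus/0]_(k : index) if nonzero k then 0 else dft n G k 0).
exists (fun r => \big[Rplus/0]_(k : index) q k r); split=> r.
  apply: derivable_pt_lim_Rsum => k.
  rewrite dotv_vscale dotvC -/(c k) /q; case: (boolP (nonzero k)) => hk.
    have c0 := small_divisor_neq0 k hk.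
    apply: derivable_pt_lim_eq.
      apply: derivable_pt_lim_scal; apply: (derivable_pt_lim_affine (dft n G k)).
      exact: derivable_dft.
    (* The quarter turn in [q] and that of the derivative add up to a half turn, whose sign cancels
       the minus in [q]. *)
    have := dft_phase_sub n G k (2 * PI * c k * r + PI / 2 + PI / 2) (2 * PI * c k * r).
    have -> : (2 * PI * c k * r + PI / 2 + PI / 2 - 2 * PI * c k * r) / 2 = PI / 2 by field.
    have -> : (2 * PI * c k * r + PI / 2 + PI / 2 + 2 * PI * c k * r) / 2 + PI / 2 =
              2 * PI * c k * r + PI / 2 + PI / 2 by field.
    rewrite sin_PI2.
    have -> : 2 * PI * (r * c k) = 2 * PI * c k * r by ring.
    set X := dft _ _ _ (_ + _); set Y := dft _ _ _ _ => e.
    have -> : Y = - X by lra.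
    by field; split; [|lra].
  have -> : c k = 0.
    by rewrite /c (zero_freqv k hk); apply: big1 => i _; ring.
  rewrite !Rmult_0_r.
  apply: derivable_pt_lim_eq.
    by apply: derivable_pt_lim_scal; apply: derivable_pt_lim_id.
  by rewrite Rmult_1_r.
have -> : \big[Rplus/0]_(k : index) q k r -
   (\big[Rplus/0]_(k : index) if nonzero k then 0 else dft n G k 0) * r =
   \big[Rplus/0]_(k | nonzero k) q k r.
  rewrite Rmult_comm -Rsum_mull -Rsum_sub (bigID nonzero) /= [X in _ + X]big1 ?Rplus_0_r.
    by apply: eq_bigr => k ->; ring.
  by move=> k /negPf hk; rewrite /q hk; ring.
apply: Rle_trans (Rabs_Rsum _ _ _) _.
apply: sum_nonzero_le p_gt1 p_le _ _.
  by apply: Rmult_le_pos => //; apply/Rlt_le/Rinv_0_lt_compat.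
move=> k hk; rewrite /q hk.
have hdft := dft_le_normv_pow k (2 * PI * c k * r + PI / 2) hk.
have hsd := small_divisor k hk.
set x := normv _ in hdft hsd *.
have xs := Rpower_gt0 x (- sigma).
have cx0 := Rmult_lt_0_compat _ _ Cxi_gt0 xs.
have hinv : / (2 * PI * Rabs (c k)) <= / (Cxi * Rpower x (- sigma)).
  by apply: Rinv_le_contravar => //; nra.
rewrite Rabs_mult Rabs_Ropp Rabs_inv (Rabs_mult (2 * PI)) (Rabs_right (2 * PI)); last lra.
have inv0 : 0 <= / (2 * PI * Rabs (c k)).
  by apply/Rlt_le/Rinv_0_lt_compat; nra.
have -> : - (INR m - sigma) = - INR m + - (- sigma) by ring.
rewrite Rpower_plus (Rpower_Ropp _ (- sigma)).
have -> : B / Cxi * (Rpower x (- INR m) * / Rpower x (- sigma)) =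
  / (Cxi * Rpower x (- sigma)) * (B * Rpower x (- INR m)) by field; lra.
exact: Rmult_le_compat (Rabs_pos _) hinv hdft.
Qed.

End Spectrum.

(** * Approximate antiderivatives on fine grids *)

Lemma fine_grid t : 0 < t -> exists n : nat, / INR n.*2.+1 <= t.
Proof.
move=> t0; have [n hn] := INR_archimed t 1 t0; exists n.
have hN := INR_N_gt0 n; apply: (Rmult_le_reg_l (INR n.*2.+1)) => //.
rewrite Rinv_r; last lra.
by rewrite INR_N; have := pos_INR n; nra.
Qed.

(** [D] is fixed before [eta]: refining the grid improves the approximation of [G] without enlarging
    the deviation from a linear function. *)
Lemma quasiperiodic_antiderivative {d} (xi0 : vec d) sigma (G : vec d -> R) m :
  diophantine xi0 sigma -> periodic_v G -> Cm m G -> INR m > INR d + sigma ->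
  exists D, forall eta, 0 < eta -> exists a Q Q',
    (forall r, derivable_pt_lim Q r (Q' r)) /\
    (forall r, Rabs (Q' r - G (vscale r xi0)) <= eta) /\
    (forall r, Rabs (Q r - a * r) <= D).
Proof.
move=> [s0 [Cxi [Cxi0 dioph]]] per hG mds; have pi1 := PI2_1.
have dpos := pos_INR d.
have [B [B0 hB]] := Cm_partial_pow_bounded m G hG per.
have hG1 : Cm 1 G.
  case: m hG mds {hB} => [|m] hG mds; first by move: mds => /=; lra.
  split=> [|i]; first exact: Cm_continuous hG.
  by have [G' [dG /Cm_continuous cG]] := (proj2 hG) i; exists G'.
have [B1 [B10 hB1]] := Cm_partial_pow_bounded 1 G hG1 per.
(* The exponent splits evenly among the coordinates, [p = (m - sigma) / d], which exceeds [1] by the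
   smoothness hypothesis; for [d = 0] any [p > 1] will do. *)
have [p [p1 hp]] : exists p, 1 < p /\ p * INR d <= INR m - sigma.
  case: (Rle_lt_or_eq_dec _ _ dpos) => [d0|<-]; last by exists 2; lra.
  exists ((INR m - sigma) / INR d); split.
    apply: (Rmult_lt_reg_r (INR d)) => //.
    by rewrite /Rdiv Rmult_assoc Rinv_l; lra.
  by apply: Req_le; field; lra.
pose W := (3 + 2 / (p - 1)) ^ d.
have W0 : 0 <= W.
  apply: pow_le; have : 0 < 2 / (p - 1) by apply: Rdiv_lt_0_compat; lra.
  lra.
exists (B / Cxi * W) => eta eta0.
pose s := Rmin 1 sigma.
have s01 : 0 < s <= 1 by split; [apply: Rmin_pos; lra|exact: Rmin_l].
have ss : s <= sigma by exact: Rmin_r.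
have BW : 0 <= B * W by apply: Rmult_le_pos.
(* The Hölder term and the Lipschitz term each receive [eta / 2]; the added [1] avoids a zero
   denominator. *)
pose th := eta / (4 * (B * W) + 1).
have th0 : 0 < th by apply: Rdiv_lt_0_compat; lra.
have dB : 0 <= INR d * B1 by apply: Rmult_le_pos.
have y0 : 0 < PI * (INR d + 1) by apply: Rmult_lt_0_compat; lra.
have [n hn] : exists n : nat,
    / INR n.*2.+1 <= Rmin (Rpower th (/ s) / (PI * (INR d + 1))) (eta / (2 * (INR d * B1) + 1)).
  apply: fine_grid; apply: Rmin_pos; apply: Rdiv_lt_0_compat => //; try lra.
  exact: Rpower_gt0.
have hn1 := Rle_trans _ _ _ hn (Rmin_l _ _).
have hn2 := Rle_trans _ _ _ hn (Rmin_r _ _).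
have [a [Q [dQ hQ]]] := interp_line_antiderivative n G m B per hB sigma p B0 p1 hp
  xi0 Cxi Cxi0 dioph.
exists a, Q, (fun r => interp n G (vscale r xi0)); split=> //; split=> // r.
apply: Rle_trans (interp_error n G m B per hB sigma p B0 p1 hp s B1 _ s01 ss B10 hB1) _.
rewrite -/W; set h := / INR n.*2.+1 in hn hn1 hn2 *.
have h0 : 0 < h by apply/Rinv_0_lt_compat/INR_N_gt0.
have e1 : Rpower (PI * (INR d + 1) * h) s <= th.
  have <- : Rpower (Rpower th (/ s)) s = th.
    by rewrite Rpower_mult Rinv_l; [exact: Rpower_1|lra].
  apply: Rle_Rpower_l; first lra.
  split; first by apply: Rmult_lt_0_compat.
  apply: (Rle_trans _ (PI * (INR d + 1) * (Rpower th (/ s) / (PI * (INR d + 1))))).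
    by apply: Rmult_le_compat_l => //; lra.
  by apply: Req_le; field; lra.
have e2 : 2 * (B * W) * th <= eta / 2.
  have : th * (4 * (B * W) + 1) = eta by rewrite /th; field; lra.
  by lra.
have e3 : INR d * B1 * h <= eta / 2.
  have : eta / (2 * (INR d * B1) + 1) * (2 * (INR d * B1) + 1) = eta by field; lra.
  have := Rmult_le_compat_l _ _ _ dB hn2.
  have : 0 < eta / (2 * (INR d * B1) + 1) by apply: Rdiv_lt_0_compat; lra.
  by lra.
have := Rmult_le_compat_l _ _ _ BW e1; lra.
Qed.

(** * Quasi-periodic fields *)

(** The derivative matches [g] only up to [eta], while [D] does not change with [eta]; thus no limit
    of antiderivatives has to be formed. *)
Definition linear_antiderivative (g : R -> R) D a eta := exists Q Q' : R -> R,
  (forall r, derivable_pt_lim Q r (Q' r)) /\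
  (forall r, Rabs (Q' r - g r) <= eta) /\
  (forall r, Rabs (Q r - a * r) <= D).

(** Over [[0, k]] the difference [Q - S] grows by at most [(eta + theta) * k], and by [(a - b) * k]
    up to [4 * D], one [D] for each function at each endpoint. Dividing by [k] removes [D]. *)
Lemma linear_antiderivative_slope g D a eta b theta :
  linear_antiderivative g D a eta -> linear_antiderivative g D b theta ->
  Rabs (a - b) <= eta + theta.
Proof.
move=> [Q [Q' [dQ [hQ' hQ]]]] [S [S' [dS [hS' hS]]]].
suff : Rabs (a - b) - (eta + theta) <= 0 by lra.
apply: (nat_multiples_bounded_le0 _ (4 * D)) => k; have k0 := pos_INR k.
have := derivative_bound (fun r => Q r - S r) (fun r => Q' r - S' r) (eta + theta) 0 (INR k)
  (fun r => derivable_pt_lim_minus _ _ _ _ _ (dQ r) (dS r)).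
rewrite Rminus_0_r (Rabs_right (INR k)); last lra.
move=> h; have {}h := h _.
have {}h : Rabs (Q (INR k) - S (INR k) - (Q 0 - S 0)) <= (eta + theta) * INR k.
  apply: h => r.
  have -> : Q' r - S' r = (Q' r - g r) - (S' r - g r) by ring.
  by apply: Rle_trans (Rabs_triang _ _) _; rewrite Rabs_Ropp; apply: Rplus_le_compat.
have -> : INR k * (Rabs (a - b) - (eta + theta)) = Rabs ((a - b) * INR k) - (eta + theta) * INR k.
  by rewrite Rabs_mult (Rabs_right (INR k)); [ring|lra].
have h1 := Rabs_le_inv _ _ (hQ (INR k)); have h2 := Rabs_le_inv _ _ (hS (INR k)).
have h3 := Rabs_le_inv _ _ (hQ 0); have h4 := Rabs_le_inv _ _ (hS 0).
have h5 := Rabs_le_inv _ _ h.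
suff : Rabs ((a - b) * INR k) <= (eta + theta) * INR k + 4 * D by lra.
by apply: Rabs_le; lra.
Qed.

Lemma linear_antiderivative_slope_ge g D a eta g0 :
  linear_antiderivative g D a eta -> (forall r, g0 <= g r) -> g0 - eta <= a.
Proof.
move=> [Q [Q' [dQ [hQ' hQ]]]] hg.
suff : g0 - eta - a <= 0 by lra.
apply: (nat_multiples_bounded_le0 _ (2 * D)) => k; have k0 := pos_INR k.
have h1 := Rabs_le_inv _ _ (hQ (INR k)); have h2 := Rabs_le_inv _ _ (hQ 0).
case: k0 => [k0|e]; last by rewrite -e in h1 *; lra.
have [r [e _]] := MVT_cor2 Q Q' 0 (INR k) k0 (fun r _ => dQ r).
have h3 := Rabs_le_inv _ _ (hQ' r); have h4 := hg r.
have : (g0 - eta) * (INR k - 0) <= Q' r * (INR k - 0) by apply: Rmult_le_compat_r; lra.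
rewrite -e; lra.
Qed.

Lemma mean_value_exists g D g0 : 0 < g0 -> (forall r, g0 <= g r) ->
  (forall eta, 0 < eta -> exists a, linear_antiderivative g D a eta) ->
  exists A, 0 < A /\ forall a eta, linear_antiderivative g D a eta -> Rabs (A - a) <= eta.
Proof.
move=> g00 hg ex.
have [|a e b h ha hb|A hA] := common_approximation (linear_antiderivative g D).
- by have [a ha] := ex 1 Rlt_0_1; exists a, 1.
- exact: linear_antiderivative_slope ha hb.
exists A; split=> //.
(* Two errors of [g0 / 4], that of [a] against [g0] and that of [A] against [a], leave
   [A >= g0 / 2]. *)
have [a ha] := ex (g0 / 4) ltac:(lra).
have := linear_antiderivative_slope_ge _ _ _ _ _ ha hg.
have := Rabs_le_inv _ _ (hA _ _ ha); lra.
Qed.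

Lemma le_of_small_multiples x y z : (forall eta, 0 < eta -> x <= y + eta * z) -> x <= y.
Proof.
move=> h; apply: Rnot_lt_le => lt.
have z0 := Rabs_pos z.
have d0 : 0 < 2 * (Rabs z + 1) by lra.
have e0 : 0 < (x - y) / (2 * (Rabs z + 1)) by apply: Rdiv_lt_0_compat; lra.
have h1 := h _ e0; have h2 := Rmult_le_compat_l _ _ _ (Rlt_le _ _ e0) (Rle_abs z).
have h3 : (x - y) / (2 * (Rabs z + 1)) * (2 * (Rabs z + 1)) = x - y by field; lra.
lra.
Qed.

(* Along the flow of [u' = f (u / eps)] an antiderivative of [1 / f] grows at unit speed. *)
Lemma scalar_flow_mean_speed (f : R -> R) fmax D A u eps :
  (forall r, 0 < f r <= fmax) ->
  (forall eta, 0 < eta -> exists a, linear_antiderivative (fun r => / f r) D a eta) ->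
  (forall a eta, linear_antiderivative (fun r => / f r) D a eta -> Rabs (A - a) <= eta) ->
  0 < A -> 0 < eps ->
  is_flow1 (fun x _ => f (x / eps)) u ->
  forall t x0, 0 < t -> Rabs (x0 - (u x0 t - / A * t)) <= 2 * D / A * eps.
Proof.
move=> hf ex hA A0 e0 hu t x0 t0; have [u0 du] := hu x0.
have ie := Rinv_0_lt_compat _ e0.
have main : Rabs (A * (u x0 t - x0) - t) <= 2 * D * eps.
  apply: (le_of_small_multiples _ _ (fmax * t + Rabs (u x0 t - x0))) => eta eta0.
  have [a ha] := ex eta eta0; have hAa := hA _ _ ha.
  case: ha => Q [Q' [dQ [hQ' hQ]]].
  pose y s := u x0 s / eps.
  (* This function is almost constant: its derivative is [f (y s) * (Q' (y s) - / f (y s)) / eps],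
     at most [fmax * eta / eps] in size. *)
  have dH s : derivable_pt_lim (fun s => Q (y s) - / eps * s) s
      ((Q' (y s) * f (y s) - 1) / eps).
    apply: derivable_pt_lim_eq.
      apply: derivable_pt_lim_minus.
        apply: (derivable_pt_lim_comp y Q); last exact: dQ.
        apply: (derivable_pt_lim_mult _ (fun=> / eps)); first exact: du.
        exact: derivable_pt_lim_const.
      apply: derivable_pt_lim_scal; exact: derivable_pt_lim_id.
    by rewrite /y /=; field; lra.
  have := derivative_bound _ _ (fmax * eta / eps) 0 t dH.
  rewrite Rminus_0_r (Rabs_right t) => [h|]; last lra.
  have {}h := h _.
  have {}h : Rabs (Q (y t) - / eps * t - (Q (y 0) - / eps * 0)) <= fmax * eta / eps * t.
    apply: h => s; have [f0 f1] := hf (y s).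
    rewrite /Rdiv Rabs_mult (Rabs_right (/ eps)); last lra.
    apply: Rmult_le_compat_r; first lra.
    have -> : Q' (y s) * f (y s) - 1 = f (y s) * (Q' (y s) - / f (y s)) by field; lra.
    rewrite Rabs_mult (Rabs_right (f _)); last lra.
    by apply: Rmult_le_compat => //; [lra|exact: Rabs_pos].
  have h1 := Rabs_le_inv _ _ (hQ (y t)); have h2 := Rabs_le_inv _ _ (hQ (y 0)).
  have h3 := Rabs_le_inv _ _ h.
  have h4 : Rabs (a * (y t - y 0) - / eps * t) <= 2 * D + fmax * eta / eps * t.
    by apply: Rabs_le; lra.
  have h5 : Rabs (a * (u x0 t - x0) - t) <= 2 * D * eps + fmax * eta * t.
    have -> : a * (u x0 t - x0) - t = eps * (a * (y t - y 0) - / eps * t).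
      by rewrite /y u0; field; lra.
    rewrite Rabs_mult (Rabs_right eps); last lra.
    have -> : 2 * D * eps + fmax * eta * t = eps * (2 * D + fmax * eta / eps * t).
      by field; lra.
    by apply: Rmult_le_compat_l => //; lra.
  have -> : A * (u x0 t - x0) - t = (A - a) * (u x0 t - x0) + (a * (u x0 t - x0) - t) by ring.
  apply: Rle_trans (Rabs_triang _ _) _; rewrite Rabs_mult.
  have := Rmult_le_compat_r _ _ _ (Rabs_pos (u x0 t - x0)) hAa; lra.
have -> : x0 - (u x0 t - / A * t) = - (/ A * (A * (u x0 t - x0) - t)) by field; lra.
rewrite Rabs_Ropp Rabs_mult Rabs_inv (Rabs_right A); last lra.
have -> : 2 * D / A * eps = / A * (2 * D * eps) by field; lra.
by apply: Rmult_le_compat_l => //; apply/Rlt_le/Rinv_0_lt_compat.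
Qed.

(** The mean of [1 / F] along the line is positive because [F] is bounded above, and the effective
    velocity is its inverse, a harmonic mean of [F]. *)
Lemma quasiperiodic_homogenization d (xi0 : vec d) sigma (F : vec d -> R) m :
  diophantine xi0 sigma -> periodic_v F -> Cm m F -> INR m > INR d + sigma ->
  (forall z, F z > 0) ->
  exists A C, 0 < C /\ forall eps u, 0 < eps ->
    is_flow1 (fun x _ => F (vscale (x / eps) xi0)) u ->
    forall t x0, 0 < t -> Rabs (x0 - (u x0 t - A * t)) <= C * eps.
Proof.
move=> dio per hF md F0.
have perG : periodic_v (fun z => / F z) by move=> z k; rewrite per.
have hG := Cm_inv m F F0 hF.
have [fmax hmax] := periodic_continuous_bounded F (Cm_continuous _ _ hF) per.
have [gmax hgmax] := periodic_continuous_bounded _ (Cm_continuous _ _ hG) perG.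
have hf r : 0 < F (vscale r xi0) <= fmax.
  by split; [exact: F0|apply: Rle_trans (Rle_abs _) (hmax _)].
have [D hD] := quasiperiodic_antiderivative xi0 sigma _ m dio perG hG md.
have fmax0 : 0 < fmax by have := hf 0; lra.
have hg r : / fmax <= / F (vscale r xi0).
  by have [h1 h2] := hf r; apply: Rinv_le_contravar.
have ex eta : 0 < eta ->
    exists a, linear_antiderivative (fun r => / F (vscale r xi0)) D a eta.
  by move=> /hD [a h]; exists a.
have [A [A0 hA]] := mean_value_exists _ D _ (Rinv_0_lt_compat _ fmax0) hg ex.
exists (/ A), (Rabs (2 * D / A) + 1); split; first by have := Rabs_pos (2 * D / A); lra.
move=> eps u e0 hu t x0 t0.
apply: Rle_trans (scalar_flow_mean_speed (fun r => F (vscale r xi0)) fmax D A u eps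
  hf ex hA A0 e0 hu t x0 t0) _.
by apply: Rmult_le_compat_r; have := Rle_abs (2 * D / A); lra.
Qed.

(** * From estimates of the flow to estimates of [phi] *)

Lemma lipschitz1_bound phi L x y B :
  lipschitz1 phi L -> Rabs (x - y) <= B -> Rabs (phi x - phi y) <= L * B.
Proof.
by move=> [L0 h] hB; apply: Rle_trans (h x y) _; apply: Rmult_le_compat_l.
Qed.

Theorem theorem1p7 :
  (* (1)  n > 1 *)
  (forall (n : nat) (f : vec n -> R -> vec n) (kappa C0 : R),
     (1 < n)%nat ->
     continuous_rt f -> lipschitz_rt f kappa -> periodic_rt f ->
     0 < C0 ->
     (forall v, is_flow f v ->
        forall (i : 'I_n) tau (c1 c2 : vec n), 0 < tau ->
          (forall j, 0 <= c1 j - c2 j <= 1) ->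
          v c2 tau i - v c1 tau i <= C0) ->
     forall (M : vec n), (forall i, sup_abs (fun p : vec n * R => f p.1 p.2 i) (M i)) ->
     forall (phi : vec n -> R) (L eps : R), is_Lip phi -> DLinf phi L -> 0 < eps ->
     exists xibar : vec n,
       forall u, is_flow (fun x t => f (vscale (/ eps) x) (t / eps)) u ->
       forall t (x x0 : vec n), 0 < t -> u x0 t = x ->
         Rabs (phi x0 - phi (vdrift x xibar t))
           <= L * (1 + C0 + 2 * \big[Rmax/0]_(i < n) M i) * eps)
  /\
  (* (2-1)  n = 1, f(r, tau) periodic *)
  (forall (f : R -> R -> R) (kappa M : R),
     continuous_rt1 f -> lipschitz_rt1 f kappa -> periodic_rt1 f ->
     sup_abs (fun p : R * R => f p.1 p.2) M ->
     forall (phi : R -> R) (L eps : R), is_Lip1 phi -> DLinf1 phi L -> 0 < eps ->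
     exists xibar : R,
       forall u, is_flow1 (fun x t => f (x / eps) (t / eps)) u ->
       (forall t x x0, 0 < t -> u x0 t = x ->
          Rabs (phi x0 - phi (x - xibar * t)) <= L * (1 + 2 * M) * eps)
       /\
       ((forall r tau tau', f r tau = f r tau') ->
        forall t x x0, 0 < t -> u x0 t = x ->
          Rabs (phi x0 - phi (x - xibar * t)) <= L * eps))
  /\
  (* (2-2)  n = 1, f(r) = F(xi0 r), quasi-periodic *)
  (forall (d : nat) (xi0 : vec d) (sigma : R) (F : vec d -> R) (m : nat),
     diophantine xi0 sigma ->
     periodic_v F -> Cm m F -> INR m > INR d + sigma ->
     (forall z, F z > 0) ->
     exists C, 0 < C /\
     forall (phi : R -> R) (L eps : R), is_Lip1 phi -> DLinf1 phi L -> 0 < eps ->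
     exists xibar : R,
       forall u, is_flow1 (fun x _ => F (vscale (x / eps) xi0)) u ->
       forall t x x0, 0 < t -> u x0 t = x ->
         Rabs (phi x0 - phi (x - xibar * t)) <= L * C * eps).
Proof.

split; [|split].
- move=> n f kappa C0 _ _ lip per C00 bnd M hM phi L eps _ [lipphi _] e0.
  have hM' r tau i : Rabs (f r tau i) <= M i by apply: (proj1 (hM i)); exists (r, tau).
  have [xi hxi] := flow_homogenization f kappa C0 M lip per (Rlt_le _ _ C00) bnd hM'.
  exists xi => u hu t x x0 t0 <-.
  (* Each coordinate is controlled by its own [M i]; the max norm calls for the largest of them. *)
  rewrite Rmult_assoc; apply: lipschitz_bound => // [|i].
    have M0 : 0 <= \big[Rmax/0]_(i < n) M i by exact: bigRmax_ge0.
    by apply: Rmult_le_pos; lra.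
  have [h _] := hxi eps e0 u hu t x0 i t0; apply: Rle_trans h _.
  have Mi : M i <= \big[Rmax/0]_(i < n) M i by exact: le_bigRmax.
  by apply: Rmult_le_compat_r; lra.
- move=> f kappa M _ lip per hM phi L eps _ [lipphi _] e0.
  have hM' r tau : Rabs (f r tau) <= M by apply: (proj1 hM); exists (r, tau).
  have [xi hxi] := scalar_flow_homogenization f kappa M lip per hM'.
  exists xi => u hu; split=> [t x x0 t0 <-|aut t x x0 t0 <-];
    have [h1 h2] := hxi eps e0 u hu t x0 t0.
    by rewrite Rmult_assoc; apply: lipschitz1_bound.
  by apply: lipschitz1_bound => //; apply: h2.
- move=> d xi0 sigma F m dio per hF md F0.
  have [A [C [C0 hC]]] := quasiperiodic_homogenization d xi0 sigma F m dio per hF md F0.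
  exists C; split=> // phi L eps _ [lipphi _] e0; exists A => u hu t x x0 t0 <-.
  by rewrite Rmult_assoc; apply: lipschitz1_bound => //; apply: hC.
Qed.
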